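(* Let $H$ be a complex Hilbert space of finite dimension $n\ge 3$ and let $k$ be an integer with $1\le k\le n-1$, $n\ne 2k$, and such that $k\notin\{2,4\}$ if $n=6$. Let $f$ be a bijective transformation of $\mathcal{G}_k(H)$ sending orthogonal apartments to orthogonal apartments. Then $f$ is induced by a unitary or conjugate-unitary operator $U$ on $H$, i.e. $f(X)=U(X)$ for all $X\in\mathcal{G}_k(H)$.
   Context: $\mathcal{G}_k(H)$ denotes the Grassmannian of all $k$-dimensional subspaces of $H$. For an orthogonal base $B$ of $H$ (a set of $n$ nonzero mutually orthogonal vectors), the associated orthogonal apartment of $\mathcal{G}_k(H)$ is the set of all $k$-dimensional subspaces spanned by subsets of $B$. A conjugate-unitary operator is a bijective conjugate-linear map $U:H\to H$ with $\langle Ux,Uy\rangle=\overline{\langle x,y\rangle}$. It is not assumed that $f^{-1}$ sends orthogonal apartments to orthogonal apartments. *)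

(* Defs.v *)
From HB Require Import structures.
From mathcomp Require Import all_boot all_order all_algebra.
From mathcomp Require Import complex.
From mathcomp Require Import boolp classical_sets reals.

Set Implicit Arguments.
Unset Strict Implicit.
Unset Printing Implicit Defensive.

Import GRing.Theory Num.Theory.
Local Open Scope ring_scope.
Local Open Scope classical_set_scope.

(* A finite-dimensional complex Hilbert space is a vectType H over R[i], with
   R : realType, together with a positive definite Hermitian form
   ip : {dot H for Num.conj}, linear in its first argument and conjugate-linear
   in the second; completeness is automatic in finite dimension. *)
Notation inner_product H := {dot H for Num.conj}.

Definition grassmannian (K : fieldType) (H : vectType K) (k : nat) : Type :=
  {X : {vspace H} | \dim X == k}.

Section OrthogonalApartments.
Variables (R : realType) (H : vectType R[i]) (ip : inner_product H).

(* pairwise_orthogonal excludes the zero vector, hence also repetitions. *)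
Definition orthogonal_base (B : seq H) : Prop :=
  pairwise_orthogonal ip B /\ size B = \dim {:H}.

Definition apartment_of (k : nat) (B : seq H) : set (grassmannian H k) :=
  [set X | exists2 S : seq H, {subset S <= B} & val X = <<S>>%VS].

Definition orthogonal_apartment (k : nat) (A : set (grassmannian H k)) : Prop :=
  exists2 B : seq H, orthogonal_base B & A = apartment_of B.

Definition unitary (U : H -> H) : Prop :=
  [/\ linear U, bijective U & forall x y, ip (U x) (U y) = ip x y].

Definition conjugate_unitary (U : H -> H) : Prop :=
  [/\ linear_for (Num.conj \; *:%R) U, bijective U
    & forall x y, ip (U x) (U y) = Num.conj (ip x y)].

(* The image of a subspace is taken as a set of vectors, as U need not be
   linear. *)
Definition induced_by (k : nat) (f : grassmannian H k -> grassmannian H k)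
    (U : H -> H) : Prop :=
  forall X : grassmannian H k, [set` val (f X)] = U @` [set` val X].

End OrthogonalApartments.

(* Main.v *)
Require Import Defs.
From HB Require Import structures.
From mathcomp Require Import all_boot all_order all_fingroup all_algebra.
From mathcomp Require Import complex boolp reals.
From mathcomp Require Import zify ring.

Set Implicit Arguments.
Unset Strict Implicit.
Unset Printing Implicit Defensive.

(** By orthogonal duality one may assume [2k < n].  An apartment given by a frame
    [e] is identified with the [k]-subsets of the index set.  Rotating [e i] and
    [e j] in their plane yields another apartment whose common part with the
    first consists of the [k]-sets not separating [i] from [j]; since [f] is
    injective, and all these families have the same size, [f] permutes them.
    So [f] induces on the index set a permutation [tau] of the edges of the
    complete graph preserving the cuts of [k]-sets.  Cuts are closed under
    symmetric difference and [t (n - t)], the size of the cut of a [t]-set,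
    determines the cut type; hence [tau] preserves stars (or, if [k] and [n] are
    even and [n <> 6], cuts of 2-sets with their incidence) and comes from a
    permutation of the indices.  Thus [f] is given on every apartment by a
    bijection between frames.

    The image of a line does not depend on the frame: frames sharing a line are
    connected by rotations of two vectors, and a rotation leaves fixed two
    [k]-subspaces meeting in that line.  The resulting map of lines is injective
    and preserves orthogonality.  In coordinates it acts through a ring
    endomorphism of the complex numbers commuting with conjugation, which is the
    identity or the conjugation. *)

(** * Cuts of finite sets *)

Section Cuts.
Variable I : finType.
Implicit Types (x y z : I) (A B S T e : {set I}).

Lemma exists_subset_card A m :
  m <= #|A| -> exists2 B : {set I}, B \subset A & #|B| = m.
Proof.
move=> mA; exists [set x in take m (enum A)].
  by apply/subsetP=> x; rewrite inE => /mem_take; rewrite mem_enum.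
rewrite cardsE (card_uniqP _) ?take_uniq ?enum_uniq // size_takel //.
by rewrite -cardE.
Qed.

Lemma exists_notin A : #|A| < #|I| -> exists x, x \notin A.
Proof.
rewrite -(cardsC A) -[X in X < _]addn0 ltn_add2l => /card_gt0P[x].
by rewrite inE; exists x.
Qed.

Definition symdiff (U : finType) (A B : {set U}) := (A :\: B) :|: (B :\: A).

Lemma in_symdiff (U : finType) (A B : {set U}) u :
  (u \in symdiff A B) = (u \in A) (+) (u \in B).
Proof. by rewrite !inE; case: (u \in A); case: (u \in B). Qed.

Lemma odd_card_symdiff (U : finType) (A B : {set U}) :
  odd #|symdiff A B| = odd #|A| (+) odd #|B|.
Proof.
rewrite cardsU [_ :&: _](_ : _ = set0) ?cards0 ?subn0; last first.
  by apply/setP=> u; rewrite !inE; case: (u \in A); case: (u \in B).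
rewrite oddD -(cardsID B A) -(cardsID A B) !oddD (setIC B A).
by case: (odd #|A :&: B|); case: odd; case: odd.
Qed.

Lemma setI_symdiff A B e :
  e :&: symdiff A B = symdiff (e :&: A) (e :&: B).
Proof. by apply/setP=> x; rewrite inE !in_symdiff !inE; case: (x \in e). Qed.

Lemma imset_symdiff (U V : finType) (h : U -> V) (A B : {set U}) :
  injective h -> h @: symdiff A B = symdiff (h @: A) (h @: B).
Proof.
move=> hI; apply/setP=> v; rewrite in_symdiff; apply/idP/idP.
  by case/imsetP=> u; rewrite in_symdiff => uAB ->; rewrite !mem_imset.
have im (X : {set U}) : v \in h @: X -> exists u, v = h u.
  by case/imsetP=> u _ ->; exists u.
case E: (v \in h @: A).
  by have [u vu] := im _ E; move: E; rewrite vu !mem_imset // in_symdiff => ->.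
move=> vB; have [u vu] := im _ vB; move: E vB.
by rewrite vu !mem_imset // in_symdiff => -> ->.
Qed.

(** Peeling off two points at a time keeps the set even. *)
Lemma symdiff_ind_even (P : {set I} -> Prop) :
    P set0 -> (forall A B, P A -> P B -> P (symdiff A B)) ->
    (forall x y, x != y -> P [set x; y]) ->
  forall T, ~~ odd #|T| -> P T.
Proof.
move=> P0 PD P2 T; have [m] := ubnP #|T|; elim: m T => // m IHm T ltTm evT.
have [->|[x xT]] := set_0Vmem T; first exact: P0.
have [E|[y]] := set_0Vmem (T :\ x).
  by move: evT; rewrite (cardsD1 x) xT E cards0.
rewrite !inE => /andP[yx yT].
have D : T = symdiff [set x; y] ((T :\ x) :\ y).
  apply/setP=> z; rewrite in_symdiff !inE.
  have [->|_] := eqVneq z x; first by rewrite eq_sym (negPf yx) /=.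
  by have [->|_] := eqVneq z y.
have cT : #|T| = #|(T :\ x) :\ y|.+2.
  by rewrite (cardsD1 x) xT (cardsD1 y (T :\ x)) !inE yx yT.
rewrite D; apply: PD; first by apply: P2; rewrite eq_sym.
by apply: IHm; rewrite cT /= ?negbK in ltTm evT *; last move: evT; lia.
Qed.

Lemma symdiff_ind (P : {set I} -> Prop) :
    P set0 -> (forall A B, P A -> P B -> P (symdiff A B)) ->
  (forall x, P [set x]) -> forall T, P T.
Proof.
move=> P0 PD P1 T; have [m] := ubnP #|T|; elim: m T => // m IHm T ltTm.
have [->|[x xT]] := set_0Vmem T; first exact: P0.
have -> : T = symdiff [set x] (T :\ x).
  by apply/setP=> z; rewrite in_symdiff !inE; have [->|] := eqVneq z x.
by apply: PD => //; apply: IHm; move: ltTm; rewrite (cardsD1 x T) xT; lia.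
Qed.

(* The edges of the complete graph on [I] separated by [T]. *)
Definition cut T : {set {set I}} :=
  [set e : {set I} | (#|e| == 2) && odd #|e :&: T|].

(** The parity of [#|e :&: T|] is additive in [T]. So [cut] is linear over the field with two
    elements, and [cut_inj] reduces to its kernel. *)
Lemma cut_symdiff A B : cut (symdiff A B) = symdiff (cut A) (cut B).
Proof.
apply/setP=> e; rewrite in_symdiff !inE setI_symdiff odd_card_symdiff.
by case: (_ == 2).
Qed.

Lemma cut0 : cut set0 = set0.
Proof. by apply/setP=> e; rewrite !inE setI0 cards0 andbF. Qed.

Lemma cutC T : cut (~: T) = cut T.
Proof.
apply/setP=> e; rewrite !inE; have [e2|//] := eqVneq; congr (_ && _).
by move: e2; rewrite -(cardsID T e) setDE; lia.
Qed.

Lemma card_set1I x T : #|[set x] :&: T| = (x \in T).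
Proof.
case: (boolP (x \in T)) => xT; last first.
  apply/eqP; rewrite cards_eq0; apply/eqP/setP=> z; rewrite !inE.
  by have [->|//] := eqVneq z x; rewrite (negPf xT).
by rewrite (setIidPl _) ?cards1 // sub1set.
Qed.

(** A separated edge has exactly one endpoint in [T], so edges correspond to points of [T] times
    points of its complement. *)
Lemma card_cut T : #|cut T| = #|T| * #|~: T|.
Proof.
rewrite -cardsX -(@card_in_imset _ _ (fun p : I * I => [set p.1; p.2])).
  apply: eq_card => e; rewrite inE; apply/idP/imsetP.
    case/andP=> /cards2P[x [y [xy ->]]].
    rewrite setIUl cardsU [X in _ - #|pred_of_set X|](_ : _ = set0); last first.
      apply/setP=> z; rewrite !inE; have [->|//] := eqVneq z x.
      by rewrite (negPf xy) andbF.
    rewrite cards0 subn0 !card_set1I.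
    have [xT|xT] := boolP (x \in T); have [yT|yT] := boolP (y \in T);
      rewrite // => _.
      by exists (x, y); rewrite // !inE xT yT.
    by exists (y, x); rewrite 1?setUC // !inE xT yT.
  case=> [[x y]]; rewrite !inE /= => /andP[xT yT] ->.
  have xy : x != y by apply: contraNneq yT => <-.
  rewrite cards2 xy /= [_ :&: T](_ : _ = [set x]) ?cards1 //.
  apply/setP=> z; rewrite !inE; have [->|_] := eqVneq z x; rewrite ?xT //=.
  by have [->|//] := eqVneq z y; rewrite (negPf yT).
case=> [x y] [x' y']; rewrite !inE /= => /andP[xT yT] /andP[x'T y'T].
move=> E; have := set21 x y; have := set22 x y; rewrite E !inE.
case/orP=> /eqP Ey; first by rewrite Ey x'T in yT.
by case/orP=> /eqP Ex; [rewrite Ex Ey|rewrite -Ex xT in y'T].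
Qed.

Lemma cut_eq0 T : cut T = set0 -> T = set0 \/ T = [set: I].
Proof.
move/(congr1 (fun X : {set {set I}} => #|X|))/eqP; rewrite card_cut cards0.
rewrite muln_eq0 => /orP[] /eqP/cards0_eq E; first by left.
by right; rewrite -[T]setCK E setC0.
Qed.

Lemma symdiff_eq0 (U : finType) (A B : {set U}) : symdiff A B = set0 -> A = B.
Proof.
move=> E; apply/setP=> x; have := in_symdiff A B x; rewrite E inE.
by case: (x \in A); case: (x \in B).
Qed.

Lemma cut_inj S T : cut S = cut T -> S = T \/ S = ~: T.
Proof.
move=> E; have: cut (symdiff S T) = set0.
  by rewrite cut_symdiff E; apply/setP=> e; rewrite in_symdiff addbb in_set0.
case/cut_eq0=> [/symdiff_eq0|D]; [by left|].
right; apply/setP=> x; have := in_symdiff S T x; rewrite D !inE.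
by case: (x \in S); case: (x \in T).
Qed.

End Cuts.

(** The difference of the products is [(a - b)(n - a - b)]. Writing the larger number as the smaller
    plus [d] avoids truncated subtraction and leaves a factor [d] to cancel. *)
Lemma mul_compl_inj n a b :
  b <= n -> a <= n -> a * (n - a) = b * (n - b) -> b = a \/ b = n - a.
Proof.
move=> bn an E; have [|neq] := eqVneq b a; first by left.
right; have [ab|ba] := leqP a b.
  have [d bE] : exists d, b = a + d by exists (b - a); rewrite subnKC.
  have [c nE] : exists c, n = a + d + c by exists (n - b); lia.
  by suff : a == c by [lia]; rewrite -(@eqn_pmul2r d); nia.
have [d aE] : exists d, a = b + d by exists (a - b); lia.
have [c nE] : exists c, n = b + d + c by exists (n - a); lia.
by suff : b == c by [lia]; rewrite -(@eqn_pmul2r d); nia.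
Qed.

(** * Permutations of edges preserving the cuts of k-sets *)

Section CutMaps.
Variables (I : finType) (k : nat) (F tau : {set I} -> {set I}).
Implicit Types (x y z : I) (A B S T e : {set I}).
Hypotheses (k_gt0 : 0 < k) (k_small : 2 * k < #|I|).
Hypotheses (tau_inj : injective tau).
Hypotheses (F_card : forall S, #|S| = k -> #|F S| = k).
Hypotheses (tau_F : forall S e, #|S| = k -> #|e| = 2 ->
  (tau e \in cut (F S)) = (e \in cut S)).

Let cardC T : #|~: T| = #|I| - #|T|.
Proof. by rewrite cardsCs setCK. Qed.

Lemma tau_cut S : #|S| = k -> tau @: cut S = cut (F S).
Proof.
move=> Sk; apply/eqP; rewrite eqEcard card_imset // !card_cut !cardC F_card //.
rewrite Sk leqnn andbT; apply/subsetP=> _ /imsetP[e eS ->].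
by rewrite tau_F //; move: (eS); rewrite inE => /andP[/eqP].
Qed.

(** At first only cuts of [k]-sets are known to be sent to cuts; the sets with this property are
    closed under symmetric difference. *)
Definition cut_stable T := exists T', tau @: cut T = cut T'.

Lemma cut_stable_symdiff A B :
  cut_stable A -> cut_stable B -> cut_stable (symdiff A B).
Proof.
move=> [A' EA] [B' EB]; exists (symdiff A' B').
by rewrite !cut_symdiff imset_symdiff // EA EB.
Qed.

(** Two distinct [k]-sets sharing [k - 1] points differ exactly by a pair. *)
Lemma cut_stable_pair x y : x != y -> cut_stable [set x; y].
Proof.
move=> xy; have [|A sA cA] := @exists_subset_card I (~: [set x; y]) k.-1.
  by rewrite cardC cards2 xy; lia.
have xA : x \notin A by apply: contraL (set21 x y) => /(subsetP sA); rewrite inE.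
have yA : y \notin A by apply: contraL (set22 x y) => /(subsetP sA); rewrite inE.
have -> : [set x; y] = symdiff (x |: A) (y |: A).
  apply/setP=> z; rewrite in_symdiff !inE.
  have [->|_] := eqVneq z x; first by rewrite (negPf xy) (negPf xA).
  by have [->|_] := eqVneq z y; rewrite ?(negPf yA) // addbb.
apply: cut_stable_symdiff.
  by exists (F (x |: A)); rewrite tau_cut // cardsU1 xA cA; lia.
by exists (F (y |: A)); rewrite tau_cut // cardsU1 yA cA; lia.
Qed.

Lemma cut_stable0 : cut_stable set0.
Proof. by exists set0; rewrite cut0 imset0. Qed.

Lemma cut_stable_even T : ~~ odd #|T| -> cut_stable T.
Proof.
apply: symdiff_ind_even => //; last exact: cut_stable_pair.
  exact: cut_stable0.
exact: cut_stable_symdiff.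
Qed.

(* [t (n - t)] determines [t] up to complementation, so [tau] preserves the
   sizes of the sides of a cut. *)
Lemma cut_image_card T T' : tau @: cut T = cut T' ->
  #|T'| = #|T| \/ #|T'| = #|I| - #|T|.
Proof.
move/(congr1 (fun X : {set {set I}} => #|X|)).
rewrite card_imset // !card_cut !cardC.
have := max_card (mem T); have := max_card (mem T').
exact: mul_compl_inj.
Qed.

Lemma cut_stable_card T :
  cut_stable T -> exists2 T', tau @: cut T = cut T' & #|T'| = #|T|.
Proof.
case=> T' E; have [cT|cT] := cut_image_card E; first by exists T'.
by exists (~: T'); rewrite ?cutC // cardC cT subKn ?max_card.
Qed.

Definition cut_equivariant (p : I -> I) T := tau @: cut T = cut (p @: T).

Lemma cut_equivariant0 p : cut_equivariant p set0.
Proof. by rewrite /cut_equivariant cut0 !imset0 cut0. Qed.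

Lemma cut_equivariant_symdiff p A B : injective p ->
  cut_equivariant p A -> cut_equivariant p B ->
  cut_equivariant p (symdiff A B).
Proof.
rewrite /cut_equivariant => pI EA EB.
by rewrite cut_symdiff !imset_symdiff // cut_symdiff EA EB.
Qed.

(** A cut determines its set up to complement, and [2 * k < #|I|] tells a [k]-set from the
    complement of one by size. *)
Lemma perm_of_cut_equivariant p : injective p ->
    (forall S, #|S| = k -> cut_equivariant p S) ->
  exists s : {perm I}, forall S, #|S| = k -> F S = s @: S.
Proof.
move=> pI pE; exists (perm pI) => S Sk.
have -> : perm pI @: S = p @: S by apply: eq_imset => x; rewrite permE.
have := pE S Sk; rewrite /cut_equivariant tau_cut //.
case/cut_inj=> // E; have := F_card Sk.
by rewrite E cardC card_imset //; lia.
Qed.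

(** The parity assumption makes cuts of single points stable. By size, [tau] maps stars to stars,
    which defines [p]; every cut is a sum of stars. *)
Lemma perm_of_cuts_odd : odd k || odd #|I| ->
  exists s : {perm I}, forall S, #|S| = k -> F S = s @: S.
Proof.
move=> kn.
have star x : exists y, tau @: cut [set x] = cut [set y].
  have: cut_stable [set x].
    (* For [k] even, [#|I|] is odd, and the complement of a point is an even set with the same cut.
       For [k] odd, a point is the difference of a [k]-set and an even set. *)
    have [ok|nok] := boolP (odd k); last first.
      have [|T E] := @cut_stable_even (~: [set x]).
        by rewrite cardC cards1; case: #|I| kn (k_small); lia.
      by exists T; rewrite -cutC.
    have [|A sA cA] := @exists_subset_card I (~: [set x]) k.-1.
      by rewrite cardC cards1; lia.
    have xA : x \notin A.
      by apply/negP=> /(subsetP sA); rewrite !inE eqxx.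
    have -> : [set x] = symdiff (x |: A) A.
      apply/setP=> z; rewrite in_symdiff !inE.
      by have [->|_] := eqVneq z x; rewrite ?(negPf xA) // addbb.
    apply: cut_stable_symdiff; last by apply: cut_stable_even; lia.
    by exists (F (x |: A)); rewrite tau_cut // cardsU1 xA cA; lia.
  case/cut_stable_card=> T E; rewrite cards1 => /eqP/cards1P[y Ty].
  by exists y; rewrite E Ty.
have [p pE] := fin_all_exists star.
have pI : injective p.
  move=> x y pxy; have: tau @: cut [set x] = tau @: cut [set y].
    by rewrite !pE pxy.
  move/(imset_inj tau_inj)/cut_inj => [] E.
    by have := set11 x; rewrite E inE => /eqP.
  (* Complementary singletons would force [#|I| = 2]. *)
  have := cardC [set y]; rewrite -E !cards1; lia.
apply: (perm_of_cut_equivariant pI) => S _.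
apply: symdiff_ind => [||x]; first exact: cut_equivariant0.
  by move=> A B; apply: cut_equivariant_symdiff.
by rewrite /cut_equivariant imset_set1.
Qed.

Lemma cardI_symdiff (U : finType) (A B : {set U}) :
  #|symdiff A B| + 2 * #|A :&: B| = #|A| + #|B|.
Proof.
rewrite cardsU [X in _ - #|pred_of_set X|](_ : _ = set0); last first.
  by apply/setP=> u; rewrite !inE; case: (u \in A); case: (u \in B).
rewrite cards0 -(cardsID B A) -(cardsID A B) (setIC B A); lia.
Qed.

Lemma symdiff_pairs x y z : x != y -> x != z -> y != z ->
  symdiff [set x; y] [set x; z] = [set y; z].
Proof.
move=> xy xz yz; apply/setP=> t; rewrite in_symdiff !inE.
have [->|_] := eqVneq t x; first by rewrite (negPf xy) (negPf xz).
by have [->|_] := eqVneq t y; rewrite ?(negPf yz).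
Qed.

(* When [k] and [n] are even only the cuts of even sets are available; [tau]
   then permutes the cuts of 2-sets, and as [n <> 6] it preserves their
   incidence, hence comes from a permutation of the points. *)
Lemma perm_of_cuts_even : ~~ odd k -> ~~ odd #|I| -> #|I| != 6 ->
  exists s : {perm I}, forall S, #|S| = k -> F S = s @: S.
Proof.
(* As [k] is even and positive, [#|I| > 4]; parity and [#|I| != 6] leave at least 8. *)
move=> evk evn n6; have n8 : 8 <= #|I| by lia.
have /fin_all_exists[r rE] (P : {set I}) : exists Q,
    #|P| = 2 -> tau @: cut P = cut Q /\ #|Q| = 2.
  have [P2|P2] := eqVneq #|P| 2; last by exists P => /eqP; rewrite (negPf P2).
  have [|Q EQ cQ] := @cut_stable_card P; last by exists Q; rewrite cQ.
  by apply: cut_stable_even; rewrite P2.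
(* Incident pairs have a symmetric difference of size 2, disjoint ones of size 4. Image sizes are
   known up to [t -> #|I| - t], which exchanges 2 and 4 on 6 points but cannot do so from 8 points
   on. *)
have rI (P Q : {set I}) : #|P| = 2 -> #|Q| = 2 -> #|r P :&: r Q| = #|P :&: Q|.
  move=> P2 Q2; have [cP rP2] := rE _ P2; have [cQ rQ2] := rE _ Q2.
  have: tau @: cut (symdiff P Q) = cut (symdiff (r P) (r Q)).
    by rewrite !cut_symdiff imset_symdiff // cP cQ.
  move/cut_image_card; have := cardI_symdiff P Q.
  have := cardI_symdiff (r P) (r Q); lia.
have card2 x y : x != y -> #|[set x; y]| = 2 by rewrite cards2 => ->.
have rD x y z : x != y -> x != z -> y != z ->
    r [set y; z] = symdiff (r [set x; y]) (r [set x; z]).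
  move=> xy xz yz; have [Exy cxy] := rE _ (card2 _ _ xy).
  have [Exz cxz] := rE _ (card2 _ _ xz); have [Eyz cyz] := rE _ (card2 _ _ yz).
  have : cut (r [set y; z]) = cut (symdiff (r [set x; y]) (r [set x; z])).
    rewrite cut_symdiff -Exy -Exz -Eyz -imset_symdiff // -cut_symdiff.
    by rewrite symdiff_pairs.
  (* In the complementary case the symmetric difference of two pairs would have [#|I| - 2 >= 6]
     points. *)
  case/cut_inj=> // E; have := cardI_symdiff (r [set x; y]) (r [set x; z]).
  by have := cardC (symdiff (r [set x; y]) (r [set x; z])); rewrite -E; lia.
have cardI1 x y z : x != y -> x != z -> y != z ->
    #|[set x; y] :&: [set x; z]| = 1.
  move=> xy xz yz; have := cardI_symdiff [set x; y] [set x; z].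
  by rewrite symdiff_pairs // !card2 //; lia.
have cardI0 x y z t : x != z -> x != t -> y != z -> y != t ->
    #|[set x; y] :&: [set z; t]| = 0.
  move=> xz xt yz yt; apply/eqP; rewrite cards_eq0; apply/eqP/setP=> u.
  rewrite !inE; have [->|_] := eqVneq u x; first by rewrite (negPf xz) (negPf xt).
  by have [->|//] := eqVneq u y; rewrite (negPf yz) (negPf yt).
have pick (s : seq I) : size s < 8 -> exists x, x \notin s.
  move=> s8; have [|x] := @exists_notin I [set x in s]; last first.
    by rewrite inE; exists x.
  by rewrite cardsE; apply: leq_ltn_trans (card_size s) _; lia.
(* The images of the pairs through [v] form a star; [p v] is its centre. *)
have /fin_all_exists[p pE] v : exists a, forall w, w != v -> a \in r [set v; w].
  have [//|w1] := pick [:: v]; rewrite !inE => vw1.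
  have [//|w2] := pick [:: v; w1]; rewrite !inE negb_or => /andP[vw2 w12].
  have P12 : #|r [set v; w1] :&: r [set v; w2]| == 1.
    by rewrite rI ?card2 ?cardI1 //; rewrite // eq_sym.
  case/cards1P: P12 => a Ea; exists a => w wv.
  have : a \in r [set v; w1] :&: r [set v; w2] by rewrite Ea set11.
  rewrite inE => /andP[a1 a2].
  have [->//|ww1] := eqVneq w w1; have [->//|ww2] := eqVneq w w2.
  have /card_gt0P[b] : 0 < #|r [set v; w] :&: r [set v; w1]|.
    by rewrite rI ?card2 ?cardI1 //; rewrite // eq_sym.
  rewrite inE => /andP[bw b1].
  (* This excludes a triangle: by [rD], a point [b] of [r [set v; w1]] outside [r [set w1; w2]] also
     lies in [r [set v; w2]], so [b] is [a]. *)
  have : #|r [set v; w] :&: r [set w1; w2]| = 0.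
    by rewrite rI ?card2 ?cardI0 //; rewrite // eq_sym.
  move/cards0_eq/setP/(_ b); rewrite (@rD v w1 w2); try by rewrite // eq_sym.
  rewrite in_setI in_symdiff bw b1 in_set0 /= => /negbFE b2.
  have : b \in r [set v; w1] :&: r [set v; w2] by rewrite inE b1.
  by rewrite Ea inE => /eqP <-.
have pI : injective p.
  move=> v w pvw; apply/eqP/negP=> /negP vw.
  have [//|x] := pick [:: v; w]; rewrite !inE negb_or => /andP[xv xw].
  have [//|y] := pick [:: v; w; x]; rewrite !inE !negb_or => /and3P[yv yw yx].
  (* Disjoint pairs have disjoint images, yet [p v = p w] would lie in both. *)
  have : #|r [set v; x] :&: r [set w; y]| = 0.
    by rewrite rI ?card2 ?cardI0 //; rewrite // eq_sym.
  move/cards0_eq/setP/(_ (p v)); rewrite inE pE // pvw pE //.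
  by rewrite inE.
apply: (perm_of_cut_equivariant pI) => S Sk.
apply: symdiff_ind_even; last by rewrite Sk.
- exact: cut_equivariant0.
- by move=> A B; apply: cut_equivariant_symdiff.
- move=> x y xy; have [E c2] := rE _ (card2 _ _ xy).
  rewrite /cut_equivariant E imsetU1 imset_set1; congr cut; apply/esym/eqP.
  rewrite eqEcard c2 card2 ?(inj_eq pI) // andbT.
  apply/subsetP=> z; rewrite !inE => /orP[] /eqP ->.
    by apply: pE; rewrite eq_sym.
  by rewrite setUC; apply: pE.
Qed.

(** On 6 points [2 * k < 6] leaves 2 as the only positive even value of [k]. *)
Theorem perm_of_cuts : (#|I| = 6 -> k != 2) ->
  exists s : {perm I}, forall S, #|S| = k -> F S = s @: S.
Proof.
move=> n6; have [|] := boolP (odd k || odd #|I|); first exact: perm_of_cuts_odd.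
rewrite negb_or => /andP[evk evn]; apply: perm_of_cuts_even => //.
by apply/eqP=> n6'; have := n6 n6'; lia.
Qed.

End CutMaps.

(** * Families of [k]-sets separating or not separating two points *)

Section SeparatingSets.
Variables (I : finType) (k : nat).
Implicit Types (i j p q : I) (S T e : {set I}).

Lemma mem_cut_pair i j S : i != j ->
  ([set i; j] \in cut S) = (i \in S) (+) (j \in S).
Proof.
move=> ij; rewrite inE cards2 ij /=.
have -> : [set i; j] :&: S = symdiff ([set i] :&: S) ([set j] :&: S).
  apply/setP=> x; rewrite in_symdiff !inE; have [->|_] := eqVneq x i => //=.
  by rewrite (negPf ij) addbF.
by rewrite odd_card_symdiff !card_set1I; case: (i \in S); case: (j \in S).
Qed.

(** A point of [e1] outside [e2], together with [k - 1] points outside both pairs, forms a [k]-set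
    separating [e1] but not [e2]; [2 * k < #|I|] leaves room for it. *)
Lemma cut_separates e1 e2 : 0 < k -> 2 * k < #|I| -> #|e1| = 2 -> #|e2| = 2 ->
  (forall S, #|S| = k -> (e1 \in cut S) = (e2 \in cut S)) -> e1 = e2.
Proof.
move=> k0 kn c1 c2 sep; apply/eqP; rewrite eqEcard c1 c2 leqnn andbT.
apply/subsetP=> x x1; apply/negPn/negP=> x2.
have [|B sB cB] := @exists_subset_card I (~: (e1 :|: e2)) k.-1.
  rewrite [#|~: _|]cardsCs setCK; have := cardsU e1 e2; rewrite c1 c2.
  by have := max_card (mem (e1 :|: e2)); lia.
have Bx y : y \in B -> (y \notin e1) && (y \notin e2).
  by move/(subsetP sB); rewrite !inE negb_or.
have xB : x \notin B by apply/negP=> /Bx; rewrite x1.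
have := sep (x |: B); rewrite cardsU1 xB cB => /(_ ltac:(lia)).
have -> : (e2 \in cut (x |: B)) = false.
  rewrite inE [e2 :&: _](_ : _ = set0) ?cards0 ?andbF //.
  apply/setP=> y; rewrite !inE; have [->|_] := eqVneq y x; first by rewrite (negPf x2).
  by have [/Bx/andP[_ /negPf->]|] := boolP (y \in B); rewrite ?andbF.
rewrite inE c1 [e1 :&: _](_ : _ = [set x]) ?cards1 //.
apply/setP=> y; rewrite !inE; have [->|_] := eqVneq y x; first by rewrite x1.
by have [/Bx/andP[/negPf-> _]|] := boolP (y \in B); rewrite ?andbF.
Qed.

Lemma exists_set_with_without i j : 0 < k -> k < #|I| -> i != j ->
  exists S : {set I}, [/\ #|S| = k, i \in S & j \notin S].
Proof.
move=> k0 kn ij; have [|B sB cB] := @exists_subset_card I (~: [set i; j]) k.-1.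
  by rewrite cardsCs setCK cards2 ij; lia.
have Bx y : y \in B -> (y != i) && (y != j).
  by move/(subsetP sB); rewrite !inE negb_or.
have iB : i \notin B by apply/negP=> /Bx; rewrite eqxx.
have jB : j \notin B by apply/negP=> /Bx; rewrite eqxx andbF.
exists (i |: B); split; rewrite ?cardsU1 ?iB ?cB ?inE ?eqxx //; first by lia.
by rewrite negb_or eq_sym ij.
Qed.

(** These sets index the members common to an apartment and its rotation in the plane of the vectors
    [i] and [j]. *)
Definition unseparated i j : {set {set I}} :=
  [set S : {set I} | (#|S| == k) && ((i \in S) == (j \in S))].

Lemma unseparatedC i j : unseparated i j = unseparated j i.
Proof. by apply/setP=> S; rewrite !inE [(i \in S) == _]eq_sym. Qed.

(** The transposition of [j] and [l] embeds the first family in the second. *)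
Lemma card_unseparated1 i j l : i != j -> i != l ->
  #|unseparated i j| <= #|unseparated i l|.
Proof.
move=> ij il; pose t := tperm j l.
have tI : injective (fun S : {set I} => t @: S) by apply/imset_inj/perm_inj.
rewrite -(card_imset _ tI); apply/subset_leq_card/subsetP=> _ /imsetP[S + ->].
rewrite !inE card_imset; last exact: perm_inj.
have mem x : (t x \in t @: S) = (x \in S) by apply/mem_imset/perm_inj.
have := mem i; have := mem j; rewrite tpermL tpermD 1?eq_sym //.
by move=> -> ->.
Qed.

Lemma card_unseparated i j p q : i != j -> p != q ->
  #|unseparated i j| = #|unseparated p q|.
Proof.
have le a b c d : a != b -> c != d -> #|unseparated a b| <= #|unseparated c d|.
  move=> ab cd; have [ac|ac] := eqVneq a c.
    by rewrite ac in ab *; apply: card_unseparated1.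
  apply: leq_trans (card_unseparated1 ab ac) _.
  by rewrite unseparatedC; apply: card_unseparated1; rewrite // eq_sym.
by move=> ij pq; apply/eqP; rewrite eqn_leq !le.
Qed.

End SeparatingSets.

Import Order.TTheory GRing.Theory Num.Theory.
Local Open Scope ring_scope.

(** * Orthogonal frames *)

Section Frames.
Variables (C : numClosedFieldType) (H : vectType C) (ip : {dot H for Num.conj}).
Variable (I : finType).
Hypothesis dimI : #|I| = \dim {:H}.
Implicit Types (u v w x y : H) (e d : I -> H) (S T : {set I}) (i j : I).

Lemma ipC u v : ip u v = (ip v u)^*.
Proof. by rewrite hermC expr0 mul1r. Qed.

Lemma ip_eq0C u v : ip u v = 0 -> ip v u = 0.
Proof. by move=> E; rewrite ipC E conjC0. Qed.

Lemma ip_neq0 u : u != 0 -> ip u u != 0.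
Proof. by rewrite dnorm_eq0. Qed.

Lemma ip_scalel a u v : ip (a *: u) v = a * ip u v.
Proof. exact: linearZl_LR. Qed.

Lemma ip_scaler a u v : ip u (a *: v) = a^* * ip u v.
Proof. exact: linearZr_LR. Qed.

Lemma ip0l u : ip 0 u = 0. Proof. exact: linear0l. Qed.

Lemma ipDl u v w : ip (u + v) w = ip u w + ip v w.
Proof. exact: linearDl. Qed.

Lemma ipBl u v w : ip (u - v) w = ip u w - ip v w.
Proof. exact: linearBl. Qed.

Lemma ipBr u v w : ip u (v - w) = ip u v - ip u w.
Proof. exact: linearBr. Qed.

Lemma ip_suml (J : finType) (P : pred J) (F : J -> H) v :
  ip (\sum_(i | P i) F i) v = \sum_(i | P i) ip (F i) v.
Proof. exact: linear_sumlz. Qed.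

Lemma ip_sumr (J : finType) (P : pred J) (F : J -> H) v :
  ip v (\sum_(i | P i) F i) = \sum_(i | P i) ip v (F i).
Proof. exact: linear_sumr. Qed.

Lemma line_eqP u v : v != 0 ->
  reflect (exists2 a, a != 0 & u = a *: v) (<[u]> == <[v]>)%VS.
Proof.
move=> v0; apply: (iffP eqP) => [E|[a a0 ->]].
  have /vlineP[a ua] : u \in <[v]>%VS by rewrite -E memv_line.
  exists a => //; apply: contraNneq v0 => a0; have := memv_line v.
  by rewrite -E ua a0 scale0r => /vlineP[b ->]; rewrite scaler0.
apply/eqP; rewrite eqEdim !dim_vline scaler_eq0 negb_or a0 v0 leqnn andbT.
by rewrite -memvE memvZ // memv_line.
Qed.

Lemma line_eq_dim u v : u \in <[v]>%VS -> u != 0 -> (<[u]> = <[v]>)%VS.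
Proof.
move=> uv u0; apply/eqP; rewrite eqEdim -memvE uv !dim_vline u0.
by case: (v != 0).
Qed.

Definition frame e := (forall i, e i != 0) /\
  (forall i j, i != j -> ip (e i) (e j) = 0).

Lemma frame_inj e : frame e -> injective e.
Proof.
move=> [e0 eo] i j eij; apply/eqP/negP=> /negP /eo; rewrite eij => /eqP.
by rewrite dnorm_eq0 (negPf (e0 j)).
Qed.

Definition frame_span e S : {vspace H} := (\sum_(i in S) <[e i]>)%VS.

Definition orth_coef e v i := ip v (e i) / ip (e i) (e i).

Lemma mem_frame_span e S i : i \in S -> e i \in frame_span e S.
Proof.
by move=> iS; rewrite memvE /frame_span (sumv_sup i).
Qed.

Lemma frame_span_ortho e S v i : frame e -> v \in frame_span e S ->
  i \notin S -> ip v (e i) = 0.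
Proof.
move=> [_ eo] /memv_sumP[vs vsE ->] iS; rewrite ip_suml big1 // => j jS.
have /vlineP[a ->] := vsE j jS; rewrite ip_scalel eo ?mulr0 //.
by apply: contraNneq iS => <-.
Qed.

Lemma dim_frame_span e S : frame e -> \dim (frame_span e S) = #|S|.
Proof.
move=> [e0 eo]; rewrite -sum1_card.
have /directvP -> /= : directv (\sum_(i in S) <[e i]>).
  apply/directv_sum_independent => us usE us0 i iS.
  have /vlineP[a ua] := usE i iS; rewrite ua.
  have: ip (\sum_(i in S) us i) (e i) = 0 by rewrite us0 ip0l.
  rewrite ip_suml (bigD1 i) //= ua big1 ?addr0 => [|j /andP[jS ji]].
    by rewrite ip_scalel => /eqP; rewrite mulf_eq0 (negPf (ip_neq0 (e0 i))) orbF
       => /eqP->; rewrite scale0r.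
  by have /vlineP[b ->] := usE j jS; rewrite ip_scalel eo ?mulr0.
by apply: eq_bigr => i _; rewrite dim_vline e0.
Qed.

Lemma frame_span_full e : frame e -> frame_span e [set: I] = fullv.
Proof.
by move=> fe; apply/eqP; rewrite eqEdim subvf dim_frame_span // cardsT dimI leqnn.
Qed.

Lemma frame_expand e v : frame e -> v = \sum_i orth_coef e v i *: e i.
Proof.
move=> fe; have: v \in frame_span e [set: I] by rewrite frame_span_full ?memvf.
case/memv_sumP=> vs vsE vE; rewrite {1}vE; apply: eq_big => [i|i _]; rewrite ?inE //.
have /vlineP[a va] := vsE i (in_setT i).
rewrite /orth_coef vE ip_suml (bigD1 i) ?inE //= big1 ?addr0 => [|j /andP[_ ji]].
  by rewrite va ip_scalel mulfK // ip_neq0 //; apply: fe.1.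
by have /vlineP[b ->] := vsE j (in_setT j); rewrite ip_scalel fe.2 ?mulr0.
Qed.

Lemma mem_frame_spanP e S v : frame e ->
  (v \in frame_span e S) <-> (forall i, i \notin S -> ip v (e i) = 0).
Proof.
move=> fe; split=> [vS i|vS]; first exact: frame_span_ortho.
rewrite (frame_expand v fe); apply: memv_suml => i _.
have [iS|iS] := boolP (i \in S); first by rewrite memvZ // mem_frame_span.
by rewrite /orth_coef vS // mul0r scale0r mem0v.
Qed.

Lemma frame_ext e v : frame e -> (forall i, ip v (e i) = 0) -> v = 0.
Proof.
move=> fe v0; rewrite (frame_expand v fe) big1 // => i _.
by rewrite /orth_coef v0 mul0r scale0r.
Qed.

Lemma frame_line e v i : frame e -> v != 0 ->
  (forall j, j != i -> ip v (e j) = 0) -> (<[v]> = <[e i]>)%VS.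
Proof.
move=> fe v0 vE; apply: line_eq_dim => //.
have -> : <[e i]>%VS = frame_span e [set i] by rewrite /frame_span big_set1.
by apply/(mem_frame_spanP _ _ fe) => j; rewrite inE; apply: vE.
Qed.

Lemma mem_frame_span_basis e S i : frame e -> (e i \in frame_span e S) = (i \in S).
Proof.
move=> fe; apply/idP/idP => [iS|]; last exact: mem_frame_span.
by apply/negPn/negP=> /(frame_span_ortho fe iS)/eqP; rewrite (negPf (ip_neq0 (fe.1 i))).
Qed.

Lemma frame_span_inj e S T : frame e -> frame_span e S = frame_span e T -> S = T.
Proof.
by move=> fe E; apply/setP=> i; rewrite -!(mem_frame_span_basis _ _ fe) E.
Qed.

Lemma eq_frame_span e d S : (forall i, i \in S -> <[e i]> = <[d i]>)%VS ->
  frame_span e S = frame_span d S.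
Proof. by move=> E; apply: eq_bigr => i /E. Qed.

Lemma frame_span_sub e S (X : {vspace H}) :
  (forall i, i \in S -> e i \in X) -> (frame_span e S <= X)%VS.
Proof. by move=> sX; apply/subv_sumP=> i iS; rewrite -memvE sX. Qed.

Lemma frame_span_eq e d S : frame e -> frame d ->
  (forall i, i \in S -> d i \in frame_span e S) -> frame_span d S = frame_span e S.
Proof.
by move=> fe fd sde; apply/eqP; rewrite eqEdim frame_span_sub // !dim_frame_span /=.
Qed.

Lemma frame_spanI e S T v : frame e ->
  v \in frame_span e S -> v \in frame_span e T -> v \in frame_span e (S :&: T).
Proof.
move=> fe vS vT; apply/(mem_frame_spanP _ _ fe) => i; rewrite inE negb_and.
by case/orP; [apply: (frame_span_ortho fe vS)|apply: (frame_span_ortho fe vT)].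
Qed.

Lemma frame_comp e (p : I -> I) : injective p -> frame e -> frame (e \o p).
Proof.
by move=> pI [e0 eo]; split=> [i|i j ij] /=; rewrite ?e0 ?eo ?(inj_eq pI).
Qed.

Lemma frame_span_comp e (p : I -> I) S : injective p ->
  frame_span (e \o p) S = frame_span e (p @: S).
Proof.
by move=> pI; rewrite /frame_span big_imset //= => i j _ _; apply: pI.
Qed.

(* Rotation of the pair [(e i, e j)] inside its plane, so that the first vector
   becomes the projection of [v] onto this plane. *)
Definition rotate e i j v l :=
  if l == i then orth_coef e v i *: e i + orth_coef e v j *: e j
  else if l == j then (ip v (e j))^* *: e i - (ip v (e i))^* *: e j
  else e l.

Lemma rotateE e i j v l : l != i -> l != j -> rotate e i j v l = e l.
Proof. by rewrite /rotate => /negPf-> /negPf->. Qed.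

(** The nonzero coordinate at [j] keeps both new vectors nonzero. *)
Lemma frame_rotate e i j v : frame e -> i != j -> ip v (e j) != 0 ->
  frame (rotate e i j v).
Proof.
move=> fe ij vj; have [e0 eo] := fe.
have ne (l : I) := ip_neq0 (e0 l).
have ji : j != i by rewrite eq_sym.
split=> [l|].
  rewrite /rotate; have [_|li] := eqVneq l i.
    apply/eqP=> /(congr1 (ip^~ (e j))).
    rewrite ipDl !ip_scalel eo // mulr0 add0r ip0l mulfVK // => /eqP.
    by rewrite (negPf vj).
  have [_|//] := eqVneq l j; apply/eqP=> /(congr1 (ip^~ (e i))).
  rewrite ipBl !ip_scalel (eo j) // mulr0 subr0 ip0l => /eqP.
  by rewrite mulf_eq0 conjC_eq0 (negPf vj) (negPf (ne i)).
have oi l : l != i -> ip (rotate e i j v i) (rotate e i j v l) = 0.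
  move=> li; rewrite /rotate eqxx (negPf li); have [_|lj] := eqVneq l j.
    rewrite ipDl !ipBr !ip_scalel !ip_scaler (eo i j) // (eo j i) //.
    by rewrite !conjCK /orth_coef; field; rewrite !ne.
  by rewrite ipDl !ip_scalel !eo ?mulr0 ?addr0 // eq_sym.
have oj l : l != i -> l != j -> ip (rotate e i j v j) (rotate e i j v l) = 0.
  move=> li lj; rewrite /rotate (negPf ji) eqxx (negPf li) (negPf lj).
  by rewrite ipBl !ip_scalel !eo ?mulr0 ?subr0 // eq_sym.
move=> l m; have [->{l}|li] := eqVneq l i; first by rewrite eq_sym; apply: oi.
have [->{m} _|mi] := eqVneq m i; first exact/ip_eq0C/oi.
have [->{l li}|lj] := eqVneq l j; first by rewrite eq_sym; apply: oj.
have [->{m mi} _|mj] := eqVneq m j; first exact/ip_eq0C/oj.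
by rewrite !rotateE //; apply: eo.
Qed.

(** A rotation towards [v] thus clears one coordinate of [v]; this makes the chains of rotations in
    [image_line] terminate. *)
Lemma ip_rotate2 e i j v : frame e -> i != j -> ip v (rotate e i j v j) = 0.
Proof.
move=> fe ij; rewrite /rotate eq_sym (negPf ij) eqxx.
by rewrite ipBr !ip_scaler !conjCK mulrC subrr.
Qed.

Lemma rotate_mem e i j v l S : (i \in S) = (j \in S) -> l \in S ->
  rotate e i j v l \in frame_span e S.
Proof.
move=> ijS lS; rewrite /rotate; have [li|_] := eqVneq l i.
  have iS : i \in S by rewrite -li.
  by rewrite memvD // memvZ // mem_frame_span // -ijS.
have [lj|_] := eqVneq l j; last exact: mem_frame_span.
have jS : j \in S by rewrite -lj.
by rewrite memvB // memvZ // mem_frame_span // ijS.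
Qed.

(** Such an [S] contains both [i] and [j] or neither, so the span contains the rotated plane or
    ignores it. *)
Lemma frame_span_rotate e i j v S : frame e -> i != j -> ip v (e j) != 0 ->
  (i \in S) = (j \in S) -> frame_span (rotate e i j v) S = frame_span e S.
Proof.
move=> fe ij vj ijS; apply: frame_span_eq => //; first exact: frame_rotate.
by move=> l; apply: rotate_mem.
Qed.

Lemma exists_orthogonal_vector (s : seq H) (X : {vspace H}) :
    (size s < \dim X)%N ->
  exists v, [/\ v \in X, v != 0 & forall w, w \in s -> ip v w = 0].
Proof.
elim: s X => [|u s IHs] X szX.
  by exists (vpick X); rewrite memv_pick vpick0 -dimv_eq0 -lt0n.
have [|v [vX v0 vs]] := IHs (X :&: orthov ip <[u]>)%VS.
  by apply: leq_trans (leq_dim_orthov1 ip u X); move: szX => /=; lia.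
move: vX; rewrite memv_cap mem_orthov1 => /andP[vX /eqP vu].
by exists v; split=> // w; rewrite inE => /predU1P[->//|/vs].
Qed.

Definition frame_on (A : {set I}) e := (forall i, i \in A -> e i != 0) /\
  {in A &, forall i j, i != j -> ip (e i) (e j) = 0}.

(** While indices of [S] are missing, fewer than [\dim X] vectors have been chosen, so [X] has a
    nonzero vector orthogonal to all of them. *)
Lemma frame_on_extend e (A S : {set I}) (X : {vspace H}) :
    frame_on A e -> A \subset S -> (forall i, i \in A -> e i \in X) ->
    (#|S| <= \dim X)%N ->
  exists d, [/\ frame_on S d, {in A, d =1 e} & forall i, i \in S -> d i \in X].
Proof.
have [m] := ubnP #|S :\: A|; elim: m A e => // m IHm A e ltm fe sAS eX SX.
have [SA|[j]] := set_0Vmem (S :\: A).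
  have -> : S = A by apply/eqP; rewrite eqEsubset sAS andbT -setD_eq0 SA.
  by exists e.
rewrite inE => /andP[jA jS].
have [|v [vX v0 vA]] := @exists_orthogonal_vector [seq e i | i <- enum A] X.
  rewrite size_map -cardE; apply: leq_trans SX; apply: proper_card.
  by apply/properP; split=> //; exists j.
have {}vA i : i \in A -> ip v (e i) = 0.
  by move=> iA; apply: vA; rewrite map_f // mem_enum.
pose e' i := if i == j then v else e i.
have eE i : i \in A -> e' i = e i.
  by rewrite /e'; have [->|//] := eqVneq i j; rewrite (negPf jA).
have [|||i|d [fd dE dX]] := IHm (j |: A) e' _ _ _ _ SX.
- have -> : S :\: (j |: A) = (S :\: A) :\ j.
    by apply/setP=> i; rewrite !inE negb_or andbA.
  by move: ltm; rewrite (cardsD1 j) inE jA jS; lia.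
- split=> [i|i l]; rewrite !inE.
    rewrite /e'; have [//|_ /=] := eqVneq i j; exact: fe.1.
  rewrite /e'; have [->|ij /=] := eqVneq i j.
    have [//|lj /= _ lA _] := eqVneq l j; exact: vA.
  have [-> iA _ _|lj /=] := eqVneq l j; first exact/ip_eq0C/vA.
  exact: fe.2.
- by rewrite subUset sub1set jS.
- by rewrite !inE /e'; have [//|_ /=] := eqVneq i j; apply: eX.
by exists d; split=> // i iA; rewrite dE ?eE // inE iA orbT.
Qed.

Lemma frame_onT e : frame_on [set: I] e -> frame e.
Proof. by case=> e0 eo; split=> [i|i j]; [apply: e0|apply: eo]; rewrite inE. Qed.

(** The family is extended first to a basis of [X], then to one of the whole space. *)
Lemma exists_frame (A S : {set I}) e (X : {vspace H}) :
    frame_on A e -> A \subset S -> (forall i, i \in A -> e i \in X) ->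
    #|S| = \dim X ->
  exists d, [/\ frame d, {in A, d =1 e} & frame_span d S = X].
Proof.
move=> fe sAS eX SX; have [|d [fd dE dX]] := frame_on_extend fe sAS eX.
  by rewrite SX.
have [|//||d' [/frame_onT fd' d'E _]] := @frame_on_extend d S [set: I] fullv fd.
- exact: subsetT.
- by move=> i _; rewrite memvf.
- by rewrite cardsT dimI.
exists d'; split=> // [i iA|]; first by rewrite d'E ?dE // (subsetP sAS).
apply/eqP; rewrite eqEdim dim_frame_span // SX leqnn andbT frame_span_sub // => i iS.
by rewrite d'E ?dX.
Qed.

Lemma exists_frame1 x i (S : {set I}) (X : {vspace H}) :
    x != 0 -> x \in X -> i \in S -> #|S| = \dim X ->
  exists d, [/\ frame d, d i = x & frame_span d S = X].
Proof.
move=> x0 xX iS SX.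
have [||//|d [fd dE dX]] := @exists_frame [set i] S (fun=> x) X _ _ _ SX.
- split=> [//|j l]; rewrite !inE => /eqP-> /eqP->; by rewrite eqxx.
- by rewrite sub1set.
by exists d; split=> //; rewrite dE ?inE.
Qed.

Lemma exists_frame2 x y i j : x != 0 -> y != 0 -> ip x y = 0 -> i != j ->
  exists d, [/\ frame d, d i = x & d j = y].
Proof.
move=> x0 y0 xy ij; have ji : j != i by rewrite eq_sym.
pose e l := if l == i then x else y.
have [|||d [fd dE _]] :=
    @exists_frame [set i; j] [set: I] e fullv _ (subsetT _) _ _.
- split=> [l|l m]; rewrite !inE /e; first by case: ifP.
  by case/orP=> /eqP-> /orP[] /eqP->; rewrite ?eqxx // ?(negPf ji) // => _;
    apply: ip_eq0C.
- by move=> l _; rewrite memvf.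
- by rewrite cardsT.
by exists d; split; rewrite // dE ?inE ?eqxx ?orbT // /e ?eqxx ?(negPf ji).
Qed.

Lemma frame_orthov e S : frame e -> orthov ip (frame_span e S) = frame_span e (~: S).
Proof.
move=> fe; apply/vspaceP=> v; apply/mem_orthovP/idP => [vS|vS u].
  apply/(mem_frame_spanP _ _ fe) => i; rewrite inE negbK => iS.
  exact/vS/mem_frame_span.
have {}vS := (mem_frame_spanP _ _ fe).1 vS.
case/memv_sumP=> us usE ->.
change (ip v (\sum_(i in S) us i) = 0); rewrite ip_sumr big1 // => i iS.
have /vlineP[a ->] := usE i iS.
by rewrite ip_scaler vS ?mulr0 // inE iS.
Qed.

Lemma exists_frame_span (X : {vspace H}) :
  exists e (S : {set I}), [/\ frame e, #|S| = \dim X & frame_span e S = X].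
Proof.
have [|S _ SX] := @exists_subset_card I [set: I] (\dim X).
  by rewrite cardsT dimI dimvS ?subvf.
have [|i|e [fe _ eS]] := @exists_frame set0 S (fun=> 0) X _ (sub0set _) _ SX.
- by split=> [i|i j]; rewrite inE.
- by rewrite inE.
by exists e, S.
Qed.

Lemma orthovK (X : {vspace H}) : orthov ip (orthov ip X) = X.
Proof.
have [e [S [fe _ <-]]] := exists_frame_span X.
by rewrite !frame_orthov // setCK.
Qed.

Lemma dim_orthov (X : {vspace H}) : \dim (orthov ip X) = (#|I| - \dim X)%N.
Proof.
have [e [S [fe _ <-]]] := exists_frame_span X.
by rewrite !frame_orthov // !dim_frame_span // cardsCs setCK.
Qed.

End Frames.

(** * Orthogonality-preserving maps of lines *)

Section OrthogonalityPreserving.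
Variables (C : numClosedFieldType) (H : vectType C) (ip : {dot H for Num.conj}).
Variable (I : finType).
Hypothesis dimI : #|I| = \dim {:H}.

Definition orthonormal_frame (e : I -> H) :=
  frame ip e /\ forall i, ip (e i) (e i) = 1.

Lemma ip_scale_inv_sqrt v (w : C) : 0 < w -> ip v v = w ->
  ip ((sqrtC w)^-1 *: v) ((sqrtC w)^-1 *: v) = 1.
Proof.
move=> w0 vw; have s0 : 0 < sqrtC w by rewrite sqrtC_gt0.
rewrite ip_scalel ip_scaler vw geC0_conj ?invr_ge0 ?ltW // mulrA -expr2.
by rewrite exprVn sqrtCK mulVf // gt_eqF.
Qed.

Lemma frame_scale (e : I -> H) (a : I -> C) : (forall i, a i != 0) ->
  frame ip e -> frame ip (fun i => a i *: e i).
Proof.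
move=> a0 [e0 eo]; split=> [i|i j ij]; first by rewrite scaler_eq0 negb_or a0 e0.
by rewrite ip_scalel ip_scaler eo // !mulr0.
Qed.

Lemma exists_orthonormal_frame : exists e, orthonormal_frame e.
Proof.
have [e [S [fe _ _]]] := exists_frame_span ip dimI 0%VS.
have w0 i : 0 < ip (e i) (e i) by rewrite dnorm_gt0 fe.1.
exists (fun i => (sqrtC (ip (e i) (e i)))^-1 *: e i); split.
  by apply: frame_scale => // i; rewrite invr_eq0 sqrtC_eq0 gt_eqF.
by move=> i; apply: ip_scale_inv_sqrt.
Qed.

Variable e : I -> H.
Hypothesis eON : orthonormal_frame e.
Let fe : frame ip e := eON.1.

Definition vec (a : I -> C) : H := \sum_i a i *: e i.

Lemma ip_vec a i : ip (vec a) (e i) = a i.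
Proof.
rewrite ip_suml (bigD1 i) //= big1 => [|j ji]; last first.
  by rewrite ip_scalel fe.2 ?mulr0.
by rewrite ip_scalel eON.2 mulr1 addr0.
Qed.

Lemma vec_coords x : vec (fun i => ip x (e i)) = x.
Proof.
rewrite [RHS](frame_expand dimI x fe); apply: eq_bigr => i _.
by rewrite /orth_coef eON.2 divr1.
Qed.

Lemma ip_vecs a b : ip (vec a) (vec b) = \sum_i a i * (b i)^*.
Proof.
rewrite ip_suml; apply: eq_bigr => i _.
by rewrite ip_scalel ipC ip_vec.
Qed.

Lemma vec_neq0 a i : a i != 0 -> vec a != 0.
Proof. by apply: contraNneq => a0; rewrite -(ip_vec a) a0 ip0l. Qed.

Lemma big_pair (i j : I) (F : I -> C) : i != j ->
  (forall l, l != i -> l != j -> F l = 0) -> \sum_l F l = F i + F j.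
Proof.
move=> ij F0; rewrite (bigD1 i) //= (bigD1 j) /= ?[j == i]eq_sym // big1 ?addr0 //.
by move=> l /andP[li lj]; apply: F0.
Qed.

Lemma big_triple (i j k : I) (F : I -> C) : i != j -> i != k -> j != k ->
    (forall l, l != i -> l != j -> l != k -> F l = 0) ->
  \sum_l F l = F i + F j + F k.
Proof.
move=> ij ik jk F0; rewrite (bigD1 i) //= (bigD1 j) /= ?[j == i]eq_sym //.
rewrite (bigD1 k) /= ?[k == _]eq_sym ?ik // big1 ?addr0 ?addrA //.
by move=> l /andP[/andP[li lj] lk]; apply: F0.
Qed.

Variable g : H -> H.
Hypothesis g_neq0 : forall x, x != 0 -> g x != 0.
Hypothesis g_ortho :
  forall x y, x != 0 -> y != 0 -> ip x y = 0 -> ip (g x) (g y) = 0.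
Hypothesis g_inj : forall x y, x != 0 -> y != 0 ->
  (<[g x]> = <[g y]>)%VS -> (<[x]> = <[y]>)%VS.

(** * Coordinates of image vectors in a frame of image lines *)

Section ImageCoordinates.
Variable u : I -> H.
Hypothesis fu : frame ip u.
Hypothesis uE : forall i, (<[u i]> = <[g (e i)]>)%VS.

Definition gcoef x i := orth_coef ip u (g x) i.

Let w i := ip (u i) (u i).

Lemma gcoef_expand x : g x = \sum_i gcoef x i *: u i.
Proof. exact: frame_expand. Qed.

Lemma ip_gcoef x y : ip (g x) (g y) = \sum_i gcoef x i * (gcoef y i)^* * w i.
Proof.
rewrite {1}(gcoef_expand x) ip_suml; apply: eq_bigr => i _.
rewrite ip_scalel -mulrA; congr (_ * _).
rewrite (gcoef_expand y) ip_sumr (bigD1 i) //= big1 ?addr0 ?ip_scaler // => j ji.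
by rewrite ip_scaler fu.2 ?mulr0 // eq_sym.
Qed.

Lemma gcoef0 x i : x != 0 -> ip x (e i) = 0 -> gcoef x i = 0.
Proof.
move=> x0 xi; rewrite /gcoef /orth_coef.
have /vlineP[a ->] : u i \in <[g (e i)]>%VS by rewrite -uE memv_line.
by rewrite ip_scaler g_ortho ?mulr0 ?mul0r //; apply: fe.1.
Qed.

(* The vector [z] of the plane [e i, e j] orthogonal to [x] is orthogonal to
   [y] as well; hence so is [g z] to [g x] and [g y]. *)
Lemma gcoef_ratio x y i j : y != 0 -> i != j -> ip x (e i) != 0 ->
    ip x (e i) * ip y (e j) = ip x (e j) * ip y (e i) ->
  gcoef x i * gcoef y j = gcoef x j * gcoef y i.
Proof.
move=> y0 ij xi0 xy; have ji : j != i by rewrite eq_sym.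
have x0 : x != 0 by apply: contraNneq xi0 => ->; rewrite ip0l.
pose z := (ip x (e j))^* *: e i - (ip x (e i))^* *: e j.
have ipz v : ip v z = ip x (e j) * ip v (e i) - ip x (e i) * ip v (e j).
  by rewrite ipBr !ip_scaler !conjCK.
have z0 : z != 0.
  apply: contraNneq xi0 => z0; have := ipz (e j).
  rewrite z0 ipC ip0l conjC0 fe.2 // eON.2 mulr0 mulr1 sub0r.
  by move/esym/eqP; rewrite oppr_eq0.
have gz l : l != i -> l != j -> gcoef z l = 0.
  move=> li lj; apply: gcoef0 => //; rewrite ipC ipz !fe.2 //.
  by rewrite !mulr0 subr0 conjC0.
have := g_ortho x0 z0; have := g_ortho y0 z0.
rewrite !ipz xy subrr [X in X - _]mulrC subrr => /(_ erefl) Ey /(_ erefl) Ex.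
move: Ex Ey; rewrite !ip_gcoef !(@big_pair i j) // => [|l li lj|l li lj];
  rewrite ?(gz l) // ?conjC0 ?mulr0 ?mul0r //.
have wn l : w l != 0 := ip_neq0 ip (fu.1 l).
(* [g z] is nonzero and has no coordinates outside [i] and [j]. *)
have: (gcoef z i)^* * w i != 0 \/ (gcoef z j)^* * w j != 0.
  rewrite !mulf_eq0 !conjC_eq0 !(negPf (wn _)) !orbF.
  have [zi|] := eqVneq (gcoef z i) 0; last by left.
  right; apply: contraNneq (g_neq0 z0) => zj.
  rewrite (gcoef_expand z) big1 // => l _.
  have [->|li] := eqVneq l i; first by rewrite zi scale0r.
  have [->|lj] := eqVneq l j; first by rewrite zj scale0r.
  by rewrite gz // scale0r.
move: (gcoef x i) (gcoef x j) (gcoef y i) (gcoef y j) => p q p' q'.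
move: (gcoef z i)^* (gcoef z j)^* (w i) (w j) => zi zj wi wj.
rewrite -!(mulrA _ _ wi) -!(mulrA _ _ wj); move: (zi * wi) (zj * wj) => a b.
move=> ab E E'.
(* [(p, q)] and [(p', q')] are both annihilated by the nonzero pair [(a, b)], hence proportional. *)
case: ab => ab; apply: (mulIf ab) => /=.
  have -> : p * q' * a = (p * a + q * b) * q' - q * (p' * a + q' * b) + q * p' * a.
    by ring.
  by rewrite E E' mul0r mulr0 subr0 add0r.
have -> : p * q' * b = (p' * a + q' * b) * p - p' * (p * a + q * b) + q * p' * b.
  by ring.
by rewrite E E' mul0r mulr0 subr0 add0r.
Qed.

(** Otherwise the projection of [x] to a plane [e i, e j] with [gcoef x j != 0] would have its image
    on the line of [g (e j)], against injectivity. *)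
Lemma gcoef_neq0 x i : ip x (e i) != 0 -> gcoef x i != 0.
Proof.
move=> xi0; have x0 : x != 0 by apply: contraNneq xi0 => ->; rewrite ip0l.
apply/eqP=> gxi.
have [j gxj] : exists j, gcoef x j != 0.
  apply/existsP; apply: contraNT (g_neq0 x0); rewrite negb_exists => /forallP gx0.
  rewrite (gcoef_expand x) big1 // => l _.
  by have /negPn/eqP-> := gx0 l; rewrite scale0r.
have ij : i != j by apply: contraNneq gxj => <-; rewrite gxi.
pose a l := if l == i then ip x (e i) else if l == j then ip x (e j) else 0.
have ai : a i = ip x (e i) by rewrite /a eqxx.
have aj : a j = ip x (e j) by rewrite /a eq_sym (negPf ij) eqxx.
have y0 : vec a != 0 by apply: (@vec_neq0 _ i); rewrite ai.
have := @gcoef_ratio x (vec a) i j y0 ij xi0; rewrite !ip_vec ai aj mulrC.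
move=> /(_ erefl); rewrite gxi mul0r => /esym/eqP.
rewrite mulf_eq0 (negPf gxj) /= => /eqP gyi.
have : (<[g (vec a)]> = <[g (e j)]>)%VS.
  rewrite -uE; apply: line_eq_dim; last exact: g_neq0.
  rewrite gcoef_expand (bigD1 j) //= big1 ?addr0 ?memvZ ?memv_line // => l lj.
  have [->|li] := eqVneq l i; first by rewrite gyi scale0r.
  by rewrite gcoef0 ?scale0r // ip_vec /a (negPf li) (negPf lj).
move/(g_inj y0 (fe.1 j))/eqP/(line_eqP _ (fe.1 j)) => [b _].
move/(congr1 (ip^~ (e i))); rewrite ip_vec ai ip_scalel (fe.2 j i) ?mulr0 1?eq_sym //.
by apply/eqP.
Qed.

End ImageCoordinates.

Lemma g_frame : frame ip (g \o e).
Proof.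
split=> [i|i j ij] /=; first exact/g_neq0/fe.1.
by apply: g_ortho; [exact: fe.1|exact: fe.1|exact: fe.2].
Qed.

Let one := vec (fun=> 1).

(** The image of the all-ones vector has only nonzero coordinates, and these serve as scaling
    factors. *)
Lemma exists_normalized_image : exists u, [/\ frame ip u,
  forall i, (<[u i]> = <[g (e i)]>)%VS & forall i, gcoef u one i = 1].
Proof.
pose a := gcoef (g \o e) one.
have a0 i : a i != 0.
  by apply: gcoef_neq0 => //; [exact: g_frame|rewrite ip_vec oner_neq0].
exists (fun i => a i *: g (e i)); split=> [|i|i].
- exact/frame_scale/g_frame.
- apply/eqP/line_eqP; [exact/g_neq0/fe.1|by exists (a i)].
rewrite /gcoef /orth_coef ip_scaler ip_scalel ip_scaler.
have ge0 := ip_neq0 ip (g_neq0 (fe.1 i)).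
have: ip (g one) (g (e i)) = a i * ip (g (e i)) (g (e i)).
  by rewrite /a /gcoef /orth_coef /= mulfVK.
move=> ->; rewrite mulrCA divff // mulf_neq0 //.
by rewrite mulf_neq0 ?conjC_eq0 //; apply: a0.
Qed.

Hypothesis I_gt2 : (2 < #|I|)%N.

Lemma exists_third (i j : I) : exists2 l, l != i & l != j.
Proof.
have [|l] := @exists_notin I [set i; j].
  by apply: leq_ltn_trans I_gt2; rewrite cards2; case: (_ != _).
by rewrite !inE negb_or => /andP[li lj]; exists l.
Qed.

(** * The scalar map governing ratios of image coordinates *)

Section Ratios.
Variable u : I -> H.
Hypothesis fu : frame ip u.
Hypothesis uE : forall i, (<[u i]> = <[g (e i)]>)%VS.
Hypothesis u_one : forall i, gcoef u one i = 1.

Let c := gcoef u.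
Let c0 := gcoef0 uE.
Let w i := ip (u i) (u i).

Definition pair_vec i j (t : C) := vec (fun l => if l == i then 1 else
  if l == j then t else 0).

(** By [gcoef_ratio] the quotient of two image coordinates depends only on the quotient [t] of the
    original ones, so the vector [e i + t e j] determines it. *)
Definition ratio i j (t : C) := c (pair_vec i j t) j / c (pair_vec i j t) i.

Lemma ratioE x i j : i != j -> ip x (e i) != 0 ->
  c x j = ratio i j (ip x (e j) / ip x (e i)) * c x i.
Proof.
move=> ij xi0; set t := _ / _.
have p0 : ip (pair_vec i j t) (e i) != 0 by rewrite ip_vec eqxx oner_neq0.
have ci : c (pair_vec i j t) i != 0 by apply: gcoef_neq0.
have y0 : pair_vec i j t != 0 by apply: contraNneq p0 => ->; rewrite ip0l.
have : c x i * c (pair_vec i j t) j = c x j * c (pair_vec i j t) i.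
  apply: gcoef_ratio => //.
  by rewrite !ip_vec !eqxx eq_sym (negPf ij) mulr1 mulrC mulfVK.
rewrite /ratio; move: ci (c x i) (c x j) (c _ j) => ci a b q E.
by rewrite mulrAC [q * a]mulrC E mulfK.
Qed.

Lemma ratio0 i j : i != j -> ratio i j 0 = 0.
Proof.
move=> ij; rewrite /ratio [c _ j]c0 ?mul0r //.
  by apply: (@vec_neq0 _ i); rewrite eqxx oner_neq0.
by rewrite ip_vec eqxx eq_sym (negPf ij).
Qed.

Lemma ratio1 i j : i != j -> ratio i j 1 = 1.
Proof.
move=> ij; have := @ratioE one i j ij; rewrite !ip_vec oner_neq0 => /(_ isT).
by rewrite divff ?oner_neq0 // /c !u_one mulr1.
Qed.

(** A vector with coordinates [1], [s], [s * t] at [i], [j], [l] is compared on the three pairs of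
    indices. *)
Lemma ratioM i j l s t : i != j -> i != l -> j != l -> s != 0 ->
  ratio i l (s * t) = ratio i j s * ratio j l t.
Proof.
move=> ij il jl s0.
pose x := vec (fun m => if m == i then 1 else if m == j then s else
  if m == l then s * t else 0).
have xi : ip x (e i) = 1 by rewrite ip_vec eqxx.
have xj : ip x (e j) = s by rewrite ip_vec eq_sym (negPf ij) eqxx.
have xl : ip x (e l) = s * t.
  by rewrite ip_vec eq_sym (negPf il) eq_sym (negPf jl) eqxx.
have xi0 : ip x (e i) != 0 by rewrite xi oner_neq0.
have cx : c x i != 0 by apply: gcoef_neq0.
have := ratioE il xi0; have := ratioE ij xi0; rewrite xi !divr1 xj xl => E1 E2.
have := @ratioE x j l jl; rewrite xj xl => /(_ s0).
have -> : s * t / s = t by rewrite mulrAC divff // mul1r.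
by rewrite E1 E2 (mulrA (ratio j l t)) => /(mulIf cx) ->; rewrite [LHS]mulrC.
Qed.

(** The normalization [ratio1] removes the second factor in [ratioM]. *)
Lemma ratio_tgt i j l : i != j -> i != l -> ratio i j =1 ratio i l.
Proof.
move=> ij il t; have [->//|jl] := eqVneq j l.
have [->|t0] := eqVneq t 0; first by rewrite !ratio0.
by have := ratioM 1 ij il jl t0; rewrite mulr1 ratio1 // mulr1.
Qed.

Lemma ratio_src i j l : i != l -> j != l -> ratio i l =1 ratio j l.
Proof.
move=> il jl t; have [->//|ij] := eqVneq i j.
by have := ratioM t ij il jl (oner_neq0 _); rewrite mul1r ratio1 // mul1r.
Qed.

(** An index [m] other than [i] and [k] serves as common target. *)
Lemma ratio_eq i j k l : i != j -> k != l -> ratio i j =1 ratio k l.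
Proof.
move=> ij kl t; have [m mi mk] := exists_third i k.
have im : i != m by rewrite eq_sym.
have km : k != m by rewrite eq_sym.
rewrite (@ratio_tgt i j m) // (@ratio_src i k m) //.
exact: ratio_tgt.
Qed.

Lemma exists_ratio : exists s : C -> C, [/\ s 0 = 0, s 1 = 1,
    {morph s : x y / x * y} &
    forall x i j, ip x (e i) != 0 -> c x j = s (ip x (e j) / ip x (e i)) * c x i].
Proof.
have /card_gt0P[i _] : (0 < #|I|)%N by apply: leq_trans I_gt2.
have [j ji _] := exists_third i i; have [l li lj] := exists_third i j.
have ij : i != j by rewrite eq_sym.
have il : i != l by rewrite eq_sym.
have jl : j != l by rewrite eq_sym.
exists (ratio i j); split.
- exact: ratio0.
- exact: ratio1.
- move=> s t /=; have [->|s0] := eqVneq s 0; first by rewrite mul0r ratio0 ?mul0r.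
  rewrite [LHS](@ratio_eq i j i l) // (@ratioM i j l) //.
  by congr (_ * _); apply: ratio_eq.
move=> x k m xk; have [->|mk] := eqVneq m k; last first.
  have km : k != m by rewrite eq_sym.
  by rewrite (@ratio_eq i j k m) //; apply: ratioE.
by rewrite divff // ratio1 // mul1r.
Qed.

Variable s : C -> C.
Hypothesis s0 : s 0 = 0.
Hypothesis s1 : s 1 = 1.
Hypothesis sM : {morph s : x y / x * y}.
Hypothesis sE :
  forall x i j, ip x (e i) != 0 -> c x j = s (ip x (e j) / ip x (e i)) * c x i.

(** Orthogonality of the two images is written in coordinates and divided by the nonzero
    [c (vec a) i] and the conjugate of [c (vec b) j]. *)
Lemma ratio_ortho a b i j : a i != 0 -> b j != 0 -> \sum_l a l * (b l)^* = 0 ->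
  \sum_l s (a l / a i) * (s (b l / b j))^* * w l = 0.
Proof.
move=> ai bj; rewrite -ip_vecs => ab.
have := g_ortho (vec_neq0 ai) (vec_neq0 bj) ab; rewrite (ip_gcoef fu) => E.
have ca : c (vec a) i != 0 by apply: gcoef_neq0; rewrite ?ip_vec.
have cb : c (vec b) j != 0 by apply: gcoef_neq0; rewrite ?ip_vec.
have cc : c (vec a) i * (c (vec b) j)^* != 0 by rewrite mulf_neq0 ?conjC_eq0.
apply: (mulfI cc); rewrite mulr0 -[RHS]E mulr_sumr; apply: eq_bigr => l _.
rewrite -/c (@sE (vec a) i l) ?ip_vec // (@sE (vec b) j l) ?ip_vec //.
rewrite (rmorphM _ (s (b l / b j))) /w /=.
move: (c (vec a) i) (c (vec b) j)^* (s (a l / a i)) (s (b l / b j))^* => p q r t.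
by ring.
Qed.

Let w_gt0 i : 0 < w i. Proof. by rewrite dnorm_gt0 fu.1. Qed.

(** The orthogonal vectors [e i + e j] and [e i - e j] give [w i + (s (-1))^* * w j = 0]. Since
    [s (-1)] squares to 1 and weights are positive, it is [-1]. *)
Lemma ratioN1_weights i j : i != j -> s (-1) = -1 /\ w i = w j.
Proof.
move=> ij; have ji : j != i by rewrite eq_sym.
pose a l : C := if l == i then 1 else if l == j then 1 else 0.
pose b l : C := if l == i then 1 else if l == j then -1 else 0.
have ai : a i = 1 by rewrite /a eqxx.
have aj : a j = 1 by rewrite /a (negPf ji) eqxx.
have bi : b i = 1 by rewrite /b eqxx.
have bj : b j = -1 by rewrite /b (negPf ji) eqxx.
have a0 l : l != i -> l != j -> a l = 0 by rewrite /a => /negPf-> /negPf->.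
have := @ratio_ortho a b i i; rewrite ai bi oner_neq0.
rewrite !(@big_pair i j) //; try by move=> l li lj; rewrite a0 // !mul0r ?s0 ?mul0r.
rewrite ai aj bi bj conjC1 mulr1 mul1r rmorphN1 addrN !divr1 s1.
move=> /(_ isT isT erefl); rewrite conjC1 !mul1r => E.
have /eqP : s (-1) ^+ 2 = 1 by rewrite expr2 -sM mulrNN mulr1.
rewrite sqrf_eq1 => /orP[] /eqP sN; rewrite sN in E *.
  by move/eqP: E; rewrite conjC1 mul1r gt_eqF // addr_gt0.
by split=> //; move/eqP: E; rewrite rmorphN1 mulN1r subr_eq0 => /eqP.
Qed.

Lemma ratio_additive_conj a b : s a + s b = (s (a + b)^*)^*.
Proof.
have /card_gt0P[i _] : (0 < #|I|)%N by apply: leq_trans I_gt2.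
have [j ji _] := exists_third i i; have [k ki kj] := exists_third i j.
have ij : i != j by rewrite eq_sym.
have ik : i != k by rewrite eq_sym.
have jk : j != k by rewrite eq_sym.
have [sN wij] := ratioN1_weights ij; have [_ wik] := ratioN1_weights ik.
pose x l : C := if l == i then a else if l == j then b else if l == k then -1 else 0.
pose y l : C := if l == i then 1 else if l == j then 1 else
  if l == k then (a + b)^* else 0.
have xi : x i = a by rewrite /x eqxx.
have xj : x j = b by rewrite /x (negPf ji) eqxx.
have xk : x k = -1 by rewrite /x (negPf ki) (negPf kj) eqxx.
have yi : y i = 1 by rewrite /y eqxx.
have yj : y j = 1 by rewrite /y (negPf ji) eqxx.
have yk : y k = (a + b)^* by rewrite /y (negPf ki) (negPf kj) eqxx.
have x0 l : l != i -> l != j -> l != k -> x l = 0.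
  by rewrite /x => /negPf-> /negPf-> /negPf->.
have := @ratio_ortho x y k i; rewrite xk yi oppr_eq0 oner_neq0.
rewrite !(@big_triple i j k) //;
  try by move=> l li lj lk; rewrite x0 // !mul0r ?s0 ?mul0r.
rewrite xi xj xk yi yj yk conjCK conjC1 !mulr1 mulN1r subrr.
move=> /(_ isT isT erefl); rewrite !divr1 s1 conjC1 !mulr1.
rewrite divff ?oppr_eq0 ?oner_neq0 // s1 mul1r -wij -wik invrN1 !sM sN.
rewrite -!mulrDl => /eqP; rewrite mulf_eq0 (gt_eqF (w_gt0 i)) orbF.
by rewrite mulrN1 addrC subr_eq0 eq_sym => /eqP.
Qed.

Lemma ratio_conj : {morph s : a / a^*}.
Proof.
move=> a; have := ratio_additive_conj a 0; rewrite s0 !addr0 => E.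
by rewrite E conjCK.
Qed.

Lemma ratioD : {morph s : a b / a + b}.
Proof. by move=> a b; rewrite ratio_additive_conj ratio_conj conjCK. Qed.

Lemma ratio_image x : x != 0 ->
  (<[g x]> = <[\sum_i s (ip x (e i)) *: u i]>)%VS.
Proof.
move=> x0; have [i xi] : exists i, ip x (e i) != 0.
  apply/existsP; apply: contraNT x0; rewrite negb_exists => /forallP x0.
  by apply/eqP/(frame_ext dimI fe) => i; have /negPn/eqP := x0 i.
have sx : s (ip x (e i)) != 0.
  apply/eqP=> E; have : s (ip x (e i) / ip x (e i)) = 1 by rewrite divff.
  rewrite sM E mul0r => /eqP.
  by rewrite eq_sym oner_eq0.
apply/eqP; rewrite eq_sym; apply/line_eqP; first exact: g_neq0.
have cx : c x i != 0 by apply: gcoef_neq0.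
exists (s (ip x (e i)) / c x i); first by rewrite mulf_neq0 ?invr_eq0.
rewrite (gcoef_expand fu) scaler_sumr; apply: eq_bigr => l _.
rewrite -/c (@sE x i l) // scalerA; congr (_ *: _).
by rewrite mulrCA mulfVK // mulrC -sM mulrC mulfVK.
Qed.

End Ratios.

(** The vectors of the normalized frame [u] have equal norms, so one common factor makes it
    orthonormal and leaves the image lines unchanged. *)
Theorem orthogonality_preserving_semilinear :
  exists (s : C -> C) (v : I -> H), [/\ orthonormal_frame v,
    [/\ s 1 = 1, {morph s : a b / a + b}, {morph s : a b / a * b}
      & {morph s : a / a^*}] &
    forall x, x != 0 -> (<[g x]> = <[\sum_i s (ip x (e i)) *: v i]>)%VS].
Proof.
have [u [fu uE u1]] := exists_normalized_image.
have [s [s0 s1 sM sE]] := exists_ratio fu uE u1.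
have /card_gt0P[i0 _] : (0 < #|I|)%N by apply: leq_trans I_gt2.
pose w := ip (u i0) (u i0).
have w0 : 0 < w by rewrite dnorm_gt0 fu.1.
have wE i : ip (u i) (u i) = w.
  have [->//|ii0] := eqVneq i i0.
  by have [_] := ratioN1_weights fu uE s0 s1 sM sE ii0.
have r0 : (sqrtC w)^-1 != 0 by rewrite invr_eq0 sqrtC_eq0 gt_eqF.
exists s, (fun i => (sqrtC w)^-1 *: u i); split.
- split; first exact: frame_scale.
  by move=> i; apply: ip_scale_inv_sqrt.
- split=> //; first exact: (ratioD fu uE s0 s1 sM sE).
  exact: (ratio_conj fu uE s0 s1 sM sE).
move=> x x0; rewrite (ratio_image fu uE s1 sM sE) //.
set y := \sum_i _; set z := \sum_i _.
have zE : z = (sqrtC w)^-1 *: y.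
  by rewrite scaler_sumr; apply: eq_bigr => i _; rewrite !scalerA mulrC.
have y0 : y != 0.
  apply: contraNneq (g_neq0 x0) => y0; have := memv_line (g x).
  rewrite (ratio_image fu uE s1 sM sE) // -/y y0 => /vlineP[b ->].
  by rewrite scaler0.
by apply/esym/eqP/line_eqP => //; exists (sqrtC w)^-1.
Qed.

End OrthogonalityPreserving.

(** * Endomorphisms of the complex numbers commuting with conjugation *)

Section ComplexEndomorphisms.
Variables (R : realType) (s : {rmorphism R[i] -> R[i]}).
Hypothesis s_conj : forall x : R[i], s x^* = (s x)^*.

Let s_real (x : R[i]) : x \is Num.real -> s x \is Num.real.
Proof. by rewrite !CrealE -s_conj => /eqP->. Qed.

(** A nonnegative number is the square of a real one, and [s] preserves reals. *)
Let s_ge0 (x : R[i]) : 0 <= x -> 0 <= s x.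
Proof.
move=> x0; rewrite -(sqrtCK x) rmorphXn real_exprn_even_ge0 // s_real //.
by rewrite ger0_real // sqrtC_ge0.
Qed.

(** On the reals [s] is monotone and fixes the rationals, which are dense. *)
Lemma rmorph_real_id (x : R[i]) : x \is Num.real -> s x = x.
Proof.
move=> xr; have /complex_realP[a xa] := xr.
have /complex_realP[b sb] := s_real xr.
have sq (q : rat) : s ((ratr q : R)%:C)%C = ((ratr q : R)%:C)%C.
  by rewrite (fmorph_rat (real_complex R)) fmorph_rat.
have s_le (y z : R) (y' z' : R) : s (y%:C)%C = (y'%:C)%C -> s (z%:C)%C = (z'%:C)%C ->
    y <= z -> y' <= z'.
  move=> Ey Ez yz; rewrite -lecR -Ey -Ez -subr_ge0 -rmorphB; apply: s_ge0.
  by rewrite subr_ge0 lecR.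
rewrite sb xa; congr (_%:C)%C; rewrite xa in sb.
have [ba|ab|//] := ltgtP b a.
  have [q] := rat_in_itvoo ba; rewrite in_itv /= => /andP[bq qa].
  by have := s_le _ _ _ _ (sq q) sb (ltW qa); rewrite leNgt bq.
have [q] := rat_in_itvoo ab; rewrite in_itv /= => /andP[aq qb].
by have := s_le _ _ _ _ sb (sq q) (ltW aq); rewrite leNgt qb.
Qed.

(** The reals are fixed and [s 'i] is a square root of [-1]. *)
Lemma rmorph_id_or_conj : s =1 id \/ s =1 Num.conj.
Proof.
have sE (x : R[i]) : s x = 'Re x + s 'i * 'Im x.
  rewrite {1}(Crect x) rmorphD rmorphM.
  by rewrite (rmorph_real_id (Creal_Re x)) (rmorph_real_id (Creal_Im x)).
have : s 'i ^+ 2 = 'i ^+ 2 by rewrite -rmorphXn sqrCi rmorphN1.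
move/eqP; rewrite eqf_sqr => /orP[] /eqP si; [left|right] => x /=.
  by rewrite sE si -Crect.
rewrite sE si [in RHS](Crect x) conjC_rect ?Creal_Re ?Creal_Im //.
by rewrite mulNr.
Qed.

End ComplexEndomorphisms.

(** * Realizing orthogonality-preserving line maps by unitary or conjugate-unitary operators *)

Section Uhlhorn.
Variables (R : realType) (H : vectType R[i]) (ip : inner_product H).
Variable I : finType.
Hypothesis dimI : #|I| = \dim {:H}.
Hypothesis I_gt2 : (2 < #|I|)%N.

Theorem orthogonality_preserving_unitary (g : H -> H) :
    (forall x, x != 0 -> g x != 0) ->
    (forall x y, x != 0 -> y != 0 -> ip x y = 0 -> ip (g x) (g y) = 0) ->
    (forall x y, x != 0 -> y != 0 -> (<[g x]> = <[g y]>)%VS -> (<[x]> = <[y]>)%VS) ->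
  exists2 U, unitary ip U \/ conjugate_unitary ip U &
    forall x, x != 0 -> (<[g x]> = <[U x]>)%VS.
Proof.
move=> g0 g1 g2; have [e eON] := exists_orthonormal_frame ip dimI.
have [s [v [vON [s1 sD sM sJ] gE]]] :=
  orthogonality_preserving_semilinear dimI eON g0 g1 g2 I_gt2.
have s0 : s 0 = 0.
  by apply: (addIr (s 0)); rewrite -sD !add0r.
have sN x : s (- x) = - s x.
  by apply: (addIr (s x)); rewrite -sD !addNr s0.
have sB : {morph s : x y / x - y} by move=> x y; rewrite sD sN.
pose sr : {rmorphism R[i] -> R[i]} := HB.pack s
  (GRing.isZmodMorphism.Build _ _ s sB)
  (GRing.isMonoidMorphism.Build _ _ s (s1, sM)).
have sC := @rmorph_id_or_conj R sr sJ.
(* Being an involution, [s] also serves in the inverse of [U], with [e] and [v] exchanged. *)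
have sK x : s (s x) = x by case: sC => /= E; rewrite !E //= conjCK.
pose U x := \sum_i s (ip x (e i)) *: v i.
have Uv x i : ip (U x) (v i) = s (ip x (e i)) by rewrite (ip_vec vON).
have eqv (f : I -> H) (y z : H) : orthonormal_frame ip f ->
    (forall i, ip y (f i) = ip z (f i)) -> y = z.
  move=> fON yz; apply/eqP; rewrite -subr_eq0; apply/eqP.
  by apply: (frame_ext dimI fON.1) => i; rewrite ipBl yz subrr.
have UP : linear_for (s \; *:%R) U.
  move=> a x y; apply: (eqv v) => // i /=.
  by rewrite ipDl ip_scalel !Uv ipDl ip_scalel sD sM.
have Ubij : bijective U.
  exists (fun y => \sum_i s (ip y (v i)) *: e i) => x.
    by apply: (eqv e) => // i; rewrite (ip_vec eON) Uv sK.
  by apply: (eqv v) => // i; rewrite Uv (ip_vec eON) sK.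
have Uip x y : ip (U x) (U y) = s (ip x y).
  rewrite (ip_vecs vON) -[in RHS](vec_coords dimI eON x) -(vec_coords dimI eON y).
  rewrite (ip_vecs eON) (big_morph s sD s0); apply: eq_bigr => i _.
  by rewrite sM sJ !(ip_vec eON).
exists U => [|x x0]; last exact: gE.
have [sE|sE] := sC; [left|right].
  by split=> // [a x y|x y]; rewrite ?UP ?Uip /= [s _]sE.
by split=> // [a x y|x y]; rewrite ?UP ?Uip /= [s _]sE.
Qed.

End Uhlhorn.

(** * Action on a single apartment *)

Section ApartmentMaps.
Variables (C : numClosedFieldType) (H : vectType C) (ip : {dot H for Num.conj}).
Variables (I : finType) (k : nat).
Hypothesis dimI : #|I| = \dim {:H}.
Hypotheses (k_gt0 : (0 < k)%N) (k_small : (2 * k < #|I|)%N).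
Hypothesis I6 : #|I| = 6%N -> k != 2%N.
Variable f : {vspace H} -> {vspace H}.
Hypothesis f_inj : forall X Y, \dim X = k -> \dim Y = k -> f X = f Y -> X = Y.
Hypothesis f_apt : forall e : I -> H, frame ip e ->
  exists2 e' : I -> H, frame ip e' &
  forall S : {set I}, #|S| = k ->
    exists2 S' : {set I}, #|S'| = k & f (frame_span e S) = frame_span e' S'.
Implicit Types (S T : {set I}) (i j p q : I) (e d : I -> H).

Let k_lt : (k < #|I|)%N.
Proof. by apply: leq_ltn_trans k_small; rewrite leq_pmull. Qed.

(* If the frame [d'] consists of multiples of vectors of [e'] then the
   apartment of [d'] is that of [e']; otherwise some vector of [d'] has two
   nonzero [e']-coordinates [p] and [q], and a common member of both apartments
   cannot separate [p] from [q]. *)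
Lemma common_apartment_unseparated e' d' : frame ip e' -> frame ip d' ->
    (forall T, exists2 T' : {set I}, #|T'| = #|T| & frame_span d' T = frame_span e' T') \/
    exists p q, p != q /\ forall S T, frame_span e' S = frame_span d' T ->
      (p \in S) = (q \in S).
Proof.
move=> fe fd.
have [al|] := pselect (forall a, exists p, (<[d' a]> = <[e' p]>)%VS).
  left=> T; have [h hE] := fin_all_exists al.
  have hI : injective h.
    move=> a b hab; apply/eqP/negP=> /negP ab.
    have := hE a; rewrite hab -hE => /eqP/(line_eqP _ (fd.1 b))[c _ dab].
    have := fd.2 a b ab; rewrite dab ip_scalel => /eqP.
    rewrite mulf_eq0 (negPf (ip_neq0 ip (fd.1 b))) orbF => /eqP c0.
    by have := fd.1 a; rewrite dab c0 scale0r eqxx.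
  exists (h @: T); first by rewrite card_imset.
  by rewrite -frame_span_comp //; apply: eq_frame_span => a _; rewrite hE.
move/existsNP=> [a /forallNP na]; right.
have [p dp] : exists p, ip (d' a) (e' p) != 0.
  apply/existsP; apply: contraNT (fd.1 a); rewrite negb_exists => /forallP d0.
  by apply/eqP/(frame_ext dimI fe) => i; have /negPn/eqP := d0 i.
have [q qp dq] : exists2 q, q != p & ip (d' a) (e' q) != 0.
  apply: contrapT => nq; apply: (na p); apply: (frame_line dimI fe (fd.1 a)) => j jp.
  by apply/eqP/negPn/negP=> dj; apply: nq; exists j.
exists p, q; split=> [|S T E]; first by rewrite eq_sym.
have [aT|aT] := boolP (a \in T).
  have dS : d' a \in frame_span e' S by rewrite E mem_frame_span.
  have mem r : ip (d' a) (e' r) != 0 -> r \in S.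
    by apply: contraR => /(frame_span_ortho fe dS) ->.
  by rewrite !mem.
have nmem r : ip (d' a) (e' r) != 0 -> r \notin S.
  apply: contra => rS; rewrite ipC conjC_eq0; apply/eqP.
  by apply: (frame_span_ortho fd _ aT); rewrite -E mem_frame_span.
by rewrite !(negPf (nmem _ _)).
Qed.

(** A set not separating [i] from [j] gives a member common to the apartments of [e] and of its
    rotation [d], so its image lies in both image apartments. These differ by injectivity, which
    yields [p] and [q]. *)
Lemma unseparated_image e e' (F : {set I} -> {set I}) :
    frame ip e -> frame ip e' ->
    (forall S, #|S| = k -> #|F S| = k /\ f (frame_span e S) = frame_span e' (F S)) ->
  forall i j, i != j -> exists p q, p != q /\
    forall S, #|S| = k -> (i \in S) = (j \in S) -> (p \in F S) = (q \in F S).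
Proof.
move=> fe fe' FE i j ij; have ji : j != i by rewrite eq_sym.
have dimk d S : frame ip d -> #|S| = k -> \dim (frame_span d S) = k.
  by move=> fd; rewrite (dim_frame_span _ fd).
(* Both coordinates being nonzero, the rotation moves both lines. *)
pose v := e i + e j.
have vi : ip v (e i) = ip (e i) (e i) by rewrite ipDl (fe.2 j i) // addr0.
have vj : ip v (e j) = ip (e j) (e j) by rewrite ipDl (fe.2 i j) // add0r.
have vj0 : ip v (e j) != 0 by rewrite vj ip_neq0 // fe.1.
pose d := rotate ip e i j v.
have fd : frame ip d by apply: frame_rotate.
have [d' fd' dE] := f_apt fd.
have [sub|[p [q [pq pqS]]]] := common_apartment_unseparated fe' fd'; last first.
  exists p, q; split=> // S Sk ijS; have [T _ ET] := dE S Sk.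
  have [_ FS] := FE S Sk; apply: (pqS _ T).
  by rewrite -FS -ET frame_span_rotate.
(* If the image of the apartment of [d] lay in that of [e], then so would the apartment of [d]
   itself, by injectivity; a set containing [i] but not [j] refutes this. *)
have [S [Sk iS jS]] := exists_set_with_without k_gt0 k_lt ij.
have [T Tk ET] := dE S Sk; have [T' cT' ET'] := sub T.
(* An injective self-map of the finite family of [k]-sets is onto. *)
have F_im : F @: [set S0 : {set I} | #|S0| == k] = [set S0 : {set I} | #|S0| == k].
  apply/eqP; rewrite eqEcard card_in_imset ?leqnn ?andbT.
    apply/subsetP=> _ /imsetP[S0 + ->]; rewrite !inE => /eqP S0k.
    by have [/eqP] := FE _ S0k.
  move=> S1 S2; rewrite !inE => /eqP k1 /eqP k2 F12.
  apply: (frame_span_inj fe); apply: f_inj; rewrite ?dimk //.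
  by have [_ ->] := FE _ k1; have [_ ->] := FE _ k2; rewrite F12.
have : T' \in F @: [set S0 : {set I} | #|S0| == k] by rewrite F_im inE cT' Tk.
case/imsetP=> S0; rewrite inE => /eqP S0k T'E.
have dS : frame_span d S = frame_span e S0.
  apply: f_inj; rewrite ?dimk //.
  by have [_ ->] := FE _ S0k; rewrite ET ET' T'E.
have diS : d i \in frame_span e S0 by rewrite -dS mem_frame_span.
have iS0 : i \in S0.
  apply/negPn/negP=> /(frame_span_ortho fe diS)/eqP.
  rewrite /d /rotate eqxx ipDl !ip_scalel (fe.2 j i) // mulr0 addr0.
  have n0 := ip_neq0 ip (fe.1 i).
  by rewrite /orth_coef vi divff // mul1r (negPf n0).
have eiS : e i \in frame_span d S by rewrite dS mem_frame_span.
have := frame_span_ortho fd eiS jS.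
rewrite /d /rotate (negPf ji) eqxx ipBr !ip_scaler (fe.2 i j) // mulr0 subr0.
rewrite conjCK vj => /eqP; rewrite mulf_eq0.
by rewrite !(negPf (ip_neq0 ip (fe.1 _))).
Qed.

(** Unseparated families are permuted, which produces the edge map required by [perm_of_cuts];
    composing [e'] with the resulting permutation aligns the indices. *)
Theorem frame_image e : frame ip e -> exists2 e', frame ip e' &
  forall S, #|S| = k -> f (frame_span e S) = frame_span e' S.
Proof.
move=> fe; have [e' fe' eE] := f_apt fe.
have /fin_all_exists[F FE] S : exists S' : {set I}, #|S| = k ->
    #|S'| = k /\ f (frame_span e S) = frame_span e' S'.
  have [Sk|Sk] := eqVneq #|S| k; last by exists S => /eqP; rewrite (negPf Sk).
  by have [S' cS' ES'] := eE S Sk; exists S'.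
have FI S T : #|S| = k -> #|T| = k -> F S = F T -> S = T.
  move=> Sk Tk FST; apply: (frame_span_inj fe).
  apply: f_inj; rewrite ?(dim_frame_span _ fe) //.
  by have [_ ->] := FE _ Sk; have [_ ->] := FE _ Tk; rewrite FST.
(* Off the pairs [tau] is the identity, so that it is injective on all sets. *)
have /fin_all_exists[tau tauE] (e2 : {set I}) : exists t : {set I},
    if #|e2| == 2%N then #|t| = 2%N /\
      forall S, #|S| = k -> (t \in cut (F S)) = (e2 \in cut S) else t = e2.
  have [/eqP/cards2P[i [j [ij ->]]]|_] := eqVneq #|e2| 2%N; last by exists e2.
  have [p [q [pq pqE]]] := unseparated_image fe fe' FE ij.
  exists [set p; q]; split=> [|S Sk]; first by rewrite cards2 pq.
  rewrite !mem_cut_pair //.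
  (* [pqE] gives one inclusion; equal sizes turn it into equality, hence an equivalence. *)
  have E : F @: unseparated k i j = unseparated k p q.
    apply/eqP; rewrite eqEcard card_in_imset.
      rewrite (card_unseparated _ ij pq) leqnn andbT.
      apply/subsetP=> _ /imsetP[T + ->]; rewrite !inE => /andP[/eqP Tk /eqP ijT].
      by rewrite (pqE _ Tk) // eqxx andbT; have [->] := FE _ Tk.
    move=> S1 S2; rewrite !inE => /andP[/eqP k1 _] /andP[/eqP k2 _].
    exact: FI.
  have [FSk _] := FE _ Sk.
  have : (F S \in unseparated k p q) = (S \in unseparated k i j).
    rewrite -E; apply/imsetP/idP => [[T + FST]|]; last by exists S.
    move=> TD; rewrite (FI S T) //.
    by move: TD; rewrite inE => /andP[/eqP].
  rewrite !inE Sk FSk eqxx /=.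
  by case: (p \in _); case: (q \in _); case: (i \in _); case: (j \in _).
have tau2 (e2 : {set I}) : #|e2| = 2%N -> #|tau e2| = 2%N.
  by move=> c2; have := tauE e2; rewrite c2 eqxx => -[].
have tauF S (e2 : {set I}) : #|S| = k -> #|e2| = 2%N ->
    (tau e2 \in cut (F S)) = (e2 \in cut S).
  by move=> Sk c2; have := tauE e2; rewrite c2 eqxx => -[_]; apply.
have tauI : injective tau.
  move=> e1 e2 E12; have := tauE e1; have := tauE e2.
  have [c2|n2] := eqVneq #|e2| 2%N; have [c1|n1] := eqVneq #|e1| 2%N.
  - move=> _ _; apply: (cut_separates k_gt0 k_small c1 c2) => S Sk.
    by rewrite -(tauF S e1) // -(tauF S e2) // E12.
  - by move=> [t2 _] t1; move: n1; rewrite -t1 E12 t2.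
  - by move=> t2 [t1 _]; move: n2; rewrite -t2 -E12 t1.
  by move=> <- <-.
have [|s sE] := perm_of_cuts k_gt0 k_small tauI _ tauF I6.
  by move=> S /FE[].
exists (e' \o s); first by apply: frame_comp => //; apply: perm_inj.
move=> S Sk; have [_ ->] := FE S Sk.
by rewrite sE // frame_span_comp //; apply: perm_inj.
Qed.

End ApartmentMaps.

(** * The induced map of lines *)

Section LineMap.
Variables (C : numClosedFieldType) (H : vectType C) (ip : {dot H for Num.conj}).
Variables (I : finType) (k : nat).
Hypothesis dimI : #|I| = \dim {:H}.
Hypotheses (k_gt0 : (0 < k)%N) (k_small : (2 * k < #|I|)%N).
Variable f : {vspace H} -> {vspace H}.
Hypothesis f_inj : forall X Y, \dim X = k -> \dim Y = k -> f X = f Y -> X = Y.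
Implicit Types (S T A : {set I}) (i j l : I) (e d : I -> H) (x y : H).

Let k_lt : (k < #|I|)%N.
Proof. by apply: leq_ltn_trans k_small; rewrite leq_pmull. Qed.

Definition frame_image_of e e' := frame ip e' /\
  forall S, #|S| = k -> f (frame_span e S) = frame_span e' S.

Hypothesis f_frame : forall e, frame ip e -> exists e', frame_image_of e e'.

(** Besides [i], [j], [l] the construction takes [2 * (k - 1)] points, which [2 * k < #|I|]
    provides. *)
Lemma exists_sets_meeting_in i j l : l != i -> l != j ->
  exists S T : {set I}, [/\ #|S| = k, #|T| = k, S :&: T = [set l] &
    forall m, m \in S :|: T -> (m != i) && (m != j)].
Proof.
move=> li lj; have cA : (#|[set i; j; l]| <= 3)%N.
  by rewrite cardsU cards2 cards1; case: (_ != _); lia.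
have [|B sB cB] := @exists_subset_card I (~: [set i; j; l]) (2 * k.-1)%N.
  by rewrite [#|~: _|]cardsCs setCK; lia.
have [|B1 sB1 cB1] := @exists_subset_card I B k.-1; first by rewrite cB; lia.
have cB2 : #|B :\: B1| = k.-1.
  by rewrite cardsD (setIidPr sB1) cB cB1; lia.
have Bm m : m \in B -> [&& m != i, m != j & m != l].
  by move/(subsetP sB); rewrite !inE !negb_or -andbA.
have lB : l \notin B by apply/negP=> /Bm; rewrite eqxx !andbF.
have lB1 : l \notin B1 by apply: contra lB; apply: subsetP.
exists (l |: B1), (l |: (B :\: B1)); split.
- by rewrite cardsU1 lB1 cB1; lia.
- by rewrite cardsU1 inE (negPf lB) andbF cB2; lia.
- apply/setP=> m; rewrite !inE; case: (m == l) => //=.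
  by case: (m \in B1).
move=> m; rewrite !inE => mST.
have [->|ml] := eqVneq m l; first by rewrite li.
have /Bm/and3P[-> ->//] : m \in B.
by move: mST; rewrite (negPf ml) /= => /orP[/(subsetP sB1)|/andP[]].
Qed.

Lemma exists_two_others i : exists j l, [/\ j != i, l != i & j != l].
Proof.
have [|j ji] := @exists_notin I [set i]; first by rewrite cards1; lia.
have [|l lij] := @exists_notin I [set i; j].
  by rewrite cards2; case: (_ != _); lia.
move: ji lij; rewrite !inE negb_or => ji /andP[li lj].
by exists j, l; rewrite ji li eq_sym.
Qed.

(** Two [k]-sets avoiding [i] and [j] and meeting only in [l] give the same subspaces for [e] and
    [d]; the images of these meet in the line sought. *)
Lemma image_line_move e d e' d' i j l : frame_image_of e e' -> frame_image_of d d' ->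
    l != i -> l != j -> (forall m, m != i -> m != j -> <[e m]> = <[d m]>)%VS ->
  (<[e' l]> = <[d' l]>)%VS.
Proof.
move=> [fe' eE] [fd' dE] li lj ed.
have [S [T [Sk Tk STl STm]]] := exists_sets_meeting_in li lj.
have sub (S0 : {set I}) : #|S0| = k -> S0 \subset S :|: T -> l \in S0 ->
    e' l \in frame_span d' S0.
  move=> S0k sS0 lS0; rewrite -dE // -(@eq_frame_span _ _ _ e) ?eE ?mem_frame_span //.
  by move=> m /(subsetP sS0)/STm/andP[mi mj]; apply: ed.
have [lS lT] : l \in S /\ l \in T.
  by apply/andP; rewrite -in_setI STl set11.
apply: line_eq_dim; last exact: fe'.1.
have := frame_spanI dimI fd' (sub S Sk (subsetUl _ _) lS) (sub T Tk (subsetUr _ _) lT).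
by rewrite STl /frame_span big_set1.
Qed.

(* Two frames sharing the line [e i0] are connected by a chain of rotations of
   pairs of vectors other than [e i0]. *)
Lemma image_line e d e' d' i0 : frame ip e -> frame ip d ->
    frame_image_of e e' -> frame_image_of d d' ->
    (<[e i0]> = <[d i0]>)%VS -> (<[e' i0]> = <[d' i0]>)%VS.
Proof.
move=> fe fd ee' dd' ed0.
(* [A] collects indices where the current frame [e1] already spans the lines of [d]; the outer
   induction enlarges it. *)
suff gen m (A : {set I}) e1 e1' : (#|~: A| < m)%N -> i0 \in A ->
    frame ip e1 -> frame_image_of e1 e1' ->
    (forall i, i \in A -> <[e1 i]> = <[d i]>)%VS -> (<[e1' i0]> = <[d' i0]>)%VS.
  apply: (gen #|~: [set i0]|.+1 [set i0] e); rewrite ?set11 //.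
  by move=> i /set1P->.
elim: m A e1 e1' => // m IHm A e1 e1'; rewrite ltnS => lem iA fe1 ee1 agA.
have [A0|[j]] := set_0Vmem (~: A).
  have [j [l [ji li _]]] := exists_two_others i0.
  apply: (image_line_move ee1 dd' (i := j) (j := l)); rewrite 1?eq_sym // => i _ _.
  by apply: agA; rewrite -(setCK A) A0 setC0 inE.
rewrite inE => jA; pose v := d j.
(* These are the nonzero coordinates of [d j] outside [j]; the inner induction removes at least one
   by each rotation of [e1 j] towards [d j]. *)
pose bad (e2 : I -> H) := [set i | (i \notin A) && (i != j) && (ip v (e2 i) != 0)].
have [c] := ubnP #|bad e1|; elim: c e1 e1' fe1 ee1 agA => // c IHc e1 e1' fe1 ee1 agA.
rewrite ltnS => lec; have [b0|[q]] := set_0Vmem (bad e1).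
  (* [d j] is now orthogonal to every [e1 l] with [l != j], so [j] joins [A]. *)
  apply: (IHm (j |: A) e1) => //.
  - rewrite setCU setIC -setDE; move: lem.
    by rewrite (cardsD1 j (~: A)) inE jA; lia.
  - by rewrite inE iA orbT.
  move=> i; rewrite !inE => /orP[/eqP->|/agA//]; apply/esym.
  apply: (frame_line dimI fe1 (fd.1 j)) => l lj.
  have [lA|lA] := boolP (l \in A).
    have /vlineP[a ->] : e1 l \in <[d l]>%VS by rewrite -agA ?memv_line.
    by rewrite ip_scaler fd.2 ?mulr0 // eq_sym.
  have := in_set0 l; rewrite -b0 inE lA lj /=.
  by move/negbT/negPn/eqP.
rewrite inE -andbA => /and3P[iNA ij vi].
have ji : j != q by rewrite eq_sym.
pose e2 := rotate ip e1 j q v.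
have fe2 : frame ip e2 by apply: frame_rotate.
have [e2' ee2] := f_frame fe2.
have i0j : i0 != j by apply: contraNneq jA => <-.
have i0i : i0 != q by apply: contraNneq iNA => <-.
have -> : (<[e1' i0]> = <[e2' i0]>)%VS.
  apply: (image_line_move ee1 ee2 i0j i0i) => l lj li.
  by rewrite /e2 rotateE.
apply: IHc ee2 _ _ => // [l lA|].
  by rewrite /e2 rotateE ?agA //; apply: contraTneq lA => ->.
apply: leq_trans lec; apply: proper_card; apply/properP; split.
  apply/subsetP=> l; rewrite !inE => /andP[/andP[-> lj]].
  rewrite lj /e2 /=; have [->|li] := eqVneq l q; first by rewrite ip_rotate2 ?eqxx.
  by rewrite rotateE.
exists q; rewrite inE ?iNA ?ij //.
by rewrite /e2 ip_rotate2 ?eqxx ?andbF.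
Qed.

(** Transposing [i] and [j] in the second frame reduces to equal indices. *)
Lemma image_line_any e d e' d' i j : frame ip e -> frame ip d ->
    frame_image_of e e' -> frame_image_of d d' ->
    (<[e i]> = <[d j]>)%VS -> (<[e' i]> = <[d' j]>)%VS.
Proof.
move=> fe fd ee' [fd' dE] ed; pose t := tperm i j.
have tI : injective t by apply: perm_inj.
have -> : d' j = (d' \o t) i by rewrite /= tpermL.
apply: (@image_line e (d \o t)) => //; last by rewrite /= tpermL.
  exact: frame_comp.
split=> [|S Sk]; first exact: frame_comp.
by rewrite (frame_span_comp d S tI) (frame_span_comp d' S tI) dE ?card_imset.
Qed.

(** [g] picks a vector on each image line: only [<[g x]>] is meaningful, and [g 0] is arbitrary. *)
Definition line_map g := forall x, x != 0 -> g x != 0 /\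
  forall e e' i, frame ip e -> frame_image_of e e' -> (<[e i]> = <[x]>)%VS ->
    (<[e' i]> = <[g x]>)%VS.

Lemma exists_line_map : exists g, line_map g.
Proof.
have /choice[g gP] x : exists y, x != 0 -> y != 0 /\
    forall e e' i, frame ip e -> frame_image_of e e' -> (<[e i]> = <[x]>)%VS ->
    (<[e' i]> = <[y]>)%VS.
  have [->|x0] := eqVneq x 0; first by exists 0.
  have /card_gt0P[i _] : (0 < #|I|)%N by lia.
  have [|||d [fd dx _]] := @exists_frame1 _ _ ip _ dimI x i [set: I] fullv x0.
  - by rewrite memvf.
  - by rewrite inE.
  - by rewrite cardsT.
  have [d' dd'] := f_frame fd; exists (d' i) => _; split; first exact: dd'.1.1.
  by move=> e e' j fe ee' ex; apply: (image_line_any fe fd) => //; rewrite dx.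
by exists g.
Qed.

Variable g : H -> H.
Hypothesis gP : line_map g.

Lemma line_mapE e e' i : frame ip e -> frame_image_of e e' ->
  (<[e' i]> = <[g (e i)]>)%VS.
Proof. by move=> fe ee'; have [_ gE] := gP (fe.1 i); apply: (gE e). Qed.

Lemma line_map_ortho x y : x != 0 -> y != 0 -> ip x y = 0 -> ip (g x) (g y) = 0.
Proof.
move=> x0 y0 xy; have /card_gt0P[i _] : (0 < #|I|)%N by lia.
have [j [_ [ji _ _]]] := exists_two_others i; rewrite eq_sym in ji.
have [e [fe ex ey]] := exists_frame2 dimI x0 y0 xy ji.
have [e' ee'] := f_frame fe.
have /vlineP[a ->] : g x \in <[e' i]>%VS by rewrite (line_mapE _ fe) // ex memv_line.
have /vlineP[b ->] : g y \in <[e' j]>%VS by rewrite (line_mapE _ fe) // ey memv_line.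
by rewrite ip_scalel ip_scaler ee'.1.2 // !mulr0.
Qed.

(** Otherwise rotate a frame through [x] and the part [v] of [y] orthogonal to [x], so that [x]
    becomes [y]. Image lines agree except possibly at [j], so a [k]-set with [i] but not [j] gives
    two subspaces with equal images, while only one of them contains [y]. *)
Lemma line_map_inj x y : x != 0 -> y != 0 ->
  (<[g x]> = <[g y]>)%VS -> (<[x]> = <[y]>)%VS.
Proof.
move=> x0 y0 gxy; pose a := ip y x / ip x x; pose v := y - a *: x.
have [v0|v0] := eqVneq v 0.
  apply/esym; apply: line_eq_dim => //; move/eqP: v0; rewrite subr_eq0 => /eqP->.
  by rewrite memvZ ?memv_line.
have xx := ip_neq0 ip x0; have vv := ip_neq0 ip v0.
have vx : ip v x = 0 by rewrite ipBl ip_scalel divfK // subrr.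
have xv := ip_eq0C vx.
have yE : y = a *: x + v by rewrite addrC subrK.
have /card_gt0P[i _] : (0 < #|I|)%N by lia.
have [j [_ [ji _ _]]] := exists_two_others i.
have ij : i != j by rewrite eq_sym.
have [e [fe ex ev]] := exists_frame2 dimI x0 v0 xv ij.
have yv : ip y v = ip v v by rewrite {1}yE ipDl ip_scalel xv mulr0 add0r.
have yj : ip y (e j) != 0 by rewrite ev yv.
pose d := rotate ip e i j y.
have fd : frame ip d by apply: frame_rotate.
have di : d i = y.
  by rewrite /d /rotate eqxx /orth_coef ex ev yv divff // scale1r -/a -yE.
have [e' ee'] := f_frame fe; have [d' dd'] := f_frame fd.
have [S [Sk iS jS]] := exists_set_with_without k_gt0 k_lt ij.
have E : frame_span e' S = frame_span d' S.
  apply: eq_frame_span => l lS; have [->|li] := eqVneq l i.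
    by rewrite (line_mapE _ fe) // (line_mapE _ fd) // ex di.
  apply: (image_line_move ee' dd' (i := i) (j := j)) => //.
    by apply: contraTneq lS => ->.
  by move=> m mi mj; rewrite /d rotateE.
have: frame_span d S = frame_span e S.
  apply: f_inj; rewrite ?(dim_frame_span _ fe) ?(dim_frame_span _ fd) //.
  by rewrite ee'.2 // dd'.2.
move=> ES; have: y \in frame_span e S by rewrite -ES -di mem_frame_span.
move/(frame_span_ortho fe)/(_ jS)/eqP.
by rewrite (negPf yj).
Qed.

Lemma line_map_mem (X : {vspace H}) x :
  \dim X = k -> x \in X -> x != 0 -> g x \in f X.
Proof.
move=> Xk xX x0; have /card_gt0P[i _] : (0 < #|I|)%N by lia.
have [j [_ [ji _ _]]] := exists_two_others i; rewrite eq_sym in ji.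
have [S [Sk iS _]] := exists_set_with_without k_gt0 k_lt ji.
have [|e [fe ex eX]] := exists_frame1 ip dimI x0 xX iS; first by rewrite Sk.
have [e' ee'] := f_frame fe; rewrite -eX ee'.2 //.
have : (<[g x]> <= frame_span e' S)%VS.
  by rewrite -ex -(line_mapE _ fe ee') -memvE mem_frame_span.
by rewrite -memvE.
Qed.

End LineMap.

(** * Isometries inducing apartment-preserving maps *)

Section InducedMaps.
Variables (R : realType) (H : vectType R[i]) (ip : inner_product H).
Variable I : finType.
Hypothesis dimI : #|I| = \dim {:H}.

Definition apartment_preserving (k : nat) (f : {vspace H} -> {vspace H}) :=
  (forall X Y, \dim X = k -> \dim Y = k -> f X = f Y -> X = Y) /\
  (forall e : I -> H, frame ip e -> exists2 e' : I -> H, frame ip e' &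
    forall S : {set I}, #|S| = k ->
      exists2 S' : {set I}, #|S'| = k & f (frame_span e S) = frame_span e' S').

Definition isometry_induces (k : nat) (f : {vspace H} -> {vspace H}) :=
  exists2 U : H -> H, unitary ip U \/ conjugate_unitary ip U &
    forall X, \dim X = k -> forall y, y \in f X <-> exists2 x, x \in X & y = U x.

Lemma isometry_ortho (U : H -> H) : unitary ip U \/ conjugate_unitary ip U ->
  bijective U /\ forall x y, ip (U x) (U y) = 0 <-> ip x y = 0.
Proof.
case=> -[_ bU Uip]; split=> // x y; rewrite Uip //.
by split=> /eqP; rewrite ?conjC_eq0 => /eqP // ->; rewrite conjC0.
Qed.

Theorem isometry_induces_small k f : (0 < k)%N -> (2 * k < #|I|)%N ->
  (#|I| = 6%N -> k != 2%N) -> apartment_preserving k f -> isometry_induces k f.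
Proof.
move=> k0 kn n6 [f_inj f_apt].
have f_frame (e : I -> H) : frame ip e -> exists e', frame_image_of ip k f e e'.
  move=> fe; have [e' fe' eE] := frame_image dimI k0 kn n6 f_inj f_apt fe.
  by exists e'.
have [g gP] := exists_line_map dimI k0 kn f_frame.
have g_neq0 x : x != 0 -> g x != 0 by case/gP.
have I_gt2 : (2 < #|I|)%N by lia.
have [U Uu UE] := orthogonality_preserving_unitary dimI I_gt2 g_neq0
  (line_map_ortho dimI k0 kn f_frame gP)
  (line_map_inj dimI k0 kn f_inj f_frame gP).
exists U => // X Xk.
have [bU Uo] := isometry_ortho Uu.
have U_neq0 x : x != 0 -> U x != 0.
  by rewrite -!(dnorm_eq0 ip); apply: contra_neq; apply: (Uo x x).1.
have UX x : x \in X -> U x \in f X.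
  have [-> _|x0 xX] := eqVneq x 0.
    suff -> : U 0 = 0 by rewrite mem0v.
    apply/eqP; rewrite -(dnorm_eq0 ip); apply/eqP.
    by apply: (Uo 0 0).2; rewrite ip0l.
  have : (<[U x]> <= f X)%VS.
    by rewrite -UE // -memvE (line_map_mem dimI k0 kn f_frame gP).
  by rewrite -memvE.
have [e [S [fe SX eX]]] := exists_frame_span ip dimI X.
have fUe : frame ip (U \o e).
  split=> [i|i j ij] /=; first exact/U_neq0/fe.1.
  exact/(Uo _ _).2/fe.2.
have [e' [fe' eE]] := f_frame e fe.
(* [U] carries a basis of [X] into [f X], and dimensions agree. *)
have fX : frame_span (U \o e) S = f X.
  apply/eqP; rewrite eqEdim frame_span_sub => [|i iS].
    by rewrite -eX eE ?(dim_frame_span _ fe') ?(dim_frame_span _ fUe) //= SX.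
  by apply: UX; rewrite -eX mem_frame_span.
move=> y; split=> [yX|[x xX ->]]; last exact: UX.
have [V VK UK] := bU; exists (V y); last by rewrite UK.
(* Membership in [X] is orthogonality to the frame vectors outside [S], which [U] preserves and
   reflects. *)
rewrite -eX; apply/(mem_frame_spanP dimI _ _ fe) => i iS.
apply: (Uo _ _).1; rewrite UK.
by apply: (frame_span_ortho fUe _ iS); rewrite fX.
Qed.

Definition dual_map (f : {vspace H} -> {vspace H}) X :=
  orthov ip (f (orthov ip X)).

(** Orthogonal complement replaces a set of frame indices by its complement, in the source frame and
    in the image frame alike. *)
Lemma apartment_preserving_dual k f : (k <= #|I|)%N ->
  apartment_preserving k f -> apartment_preserving (#|I| - k) (dual_map f).
Proof.
move=> kI [f_inj f_apt]; split=> [X Y Xk Yk|e fe].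
  move/(congr1 (orthov ip)); rewrite !(orthovK ip dimI) => /f_inj E.
  by rewrite -(orthovK ip dimI X) E ?(orthovK ip dimI) //
    (dim_orthov ip dimI) ?Xk ?Yk subKn.
have [e' fe' eE] := f_apt e fe; exists e' => // S Sk.
have [|S' S'k ES] := eE (~: S); first by rewrite cardsCs setCK Sk subKn.
exists (~: S'); first by rewrite cardsCs setCK S'k.
by rewrite /dual_map (frame_orthov dimI _ fe) ES (frame_orthov dimI _ fe').
Qed.

(** A bijection preserving and reflecting orthogonality commutes with orthogonal complement. *)
Lemma isometry_induces_dual k f : (k <= #|I|)%N ->
  isometry_induces (#|I| - k) (dual_map f) -> isometry_induces k f.
Proof.
move=> kI [U Uu UE]; exists U => // X Xk y.
have [[V VK UK] Uo] := isometry_ortho Uu.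
have mem_orth (Z : {vspace H}) z : z \in orthov ip Z <-> {in Z, forall w, ip z w = 0}.
  by split; [move/mem_orthovP|move=> zZ; apply/mem_orthovP].
have fX : f X = orthov ip (dual_map f (orthov ip X)).
  by rewrite /dual_map !(orthovK ip dimI).
have {}UE := UE (orthov ip X); rewrite (dim_orthov ip dimI) Xk in UE.
rewrite fX; split=> [/mem_orth yX|[x xX ->]]; last first.
  apply/mem_orth => _ /(UE erefl)[z /mem_orth zX ->]; apply/(Uo _ _).2.
  exact/ip_eq0C/zX.
exists (V y); last by rewrite UK.
rewrite -(orthovK ip dimI X); apply/mem_orth => z zX.
by apply/(Uo _ _).1; rewrite UK; apply: yX; apply/(UE erefl); exists z.
Qed.

(** If [2 * k > #|I|], duality passes to [#|I| - k]; on 6 points this turns the excluded value 4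
    into 2. *)
Theorem apartment_preserving_induced k f : (0 < k < #|I|)%N ->
    #|I| <> (2 * k)%N -> (#|I| = 6%N -> k \notin [:: 2; 4]%N) ->
  apartment_preserving k f -> isometry_induces k f.
Proof.
move=> /andP[k0 kn] n2k n6 fP; have [kn2|kn2] := ltnP (2 * k) #|I|.
  by apply: isometry_induces_small => // /n6; rewrite !inE negb_or => /andP[].
apply: isometry_induces_dual (ltnW kn) _; apply: isometry_induces_small.
- by rewrite subn_gt0.
- by lia.
- by move=> n6'; have := n6 n6'; rewrite n6' !inE negb_or; lia.
exact: apartment_preserving_dual (ltnW kn) fP.
Qed.

End InducedMaps.

From mathcomp Require Import classical_sets.

(** * From orthogonal bases and Grassmannians to indexed frames and subspaces *)

Section Apartments.
Variables (R : realType) (H : vectType R[i]) (ip : inner_product H).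
Variables (n k : nat).
Hypothesis dimH : \dim {:H} = n.

Lemma frame_base (e : 'I_n -> H) : frame ip e -> orthogonal_base ip (codom e).
Proof.
move=> fe; have [e0 eo] := fe; split; last by rewrite size_codom card_ord dimH.
apply/pairwise_orthogonalP; split=> /=.
  rewrite map_inj_uniq ?enum_uniq ?andbT; last exact: frame_inj fe.
  by apply/negP=> /codomP[i /esym/eqP]; rewrite (negPf (e0 i)).
move=> _ _ /codomP[i ->] /codomP[j ->] ij; apply: eo.
by apply: contraNneq ij => ->.
Qed.

Lemma base_frame (B : seq H) : orthogonal_base ip B ->
  frame ip (fun i : 'I_n => nth 0 B i).
Proof.
move=> [/pairwise_orthogonalP[/= /andP[B0 Bu] Bo] szB].
have ltB (i : 'I_n) : (i < size B)%N by rewrite szB dimH.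
split=> [i|i j ij].
  by apply/eqP=> E; have := mem_nth 0 (ltB i); rewrite E (negPf B0).
by apply: Bo; rewrite ?nth_uniq ?mem_nth ?ltB.
Qed.

Lemma span_frame_span (e : 'I_n -> H) (s : seq H) :
  {subset s <= codom e} -> <<s>>%VS = frame_span e [set i | e i \in s].
Proof.
move=> se; apply/eqP; rewrite eqEsubv; apply/andP; split.
  apply/span_subvP=> x xs; have /codomP[i xi] := se x xs.
  by rewrite xi mem_frame_span // inE -xi.
by apply: frame_span_sub => i; rewrite inE => /memv_span.
Qed.

(** Outside dimension [k] the value [X] is a mere filler. *)
Definition extend_map (f : grassmannian H k -> grassmannian H k) (X : {vspace H}) :=
  oapp (fun Y : grassmannian H k => val (f Y)) X (insub X).

Lemma extend_mapE f (X : grassmannian H k) : extend_map f (val X) = val (f X).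
Proof. by rewrite /extend_map valK. Qed.

Lemma grassmannian_val (X : {vspace H}) :
  \dim X = k -> exists Y : grassmannian H k, val Y = X.
Proof. by move/eqP=> Xk; exists (exist _ X Xk). Qed.

Lemma extend_map_apartment_preserving f : injective f ->
    (forall A : set (grassmannian H k),
      orthogonal_apartment ip A -> orthogonal_apartment ip (f @` A)%classic) ->
  apartment_preserving ip 'I_n k (extend_map f).
Proof.
move=> fI f_apt; split=> [X Y /grassmannian_val[X' <-] /grassmannian_val[Y' <-]|e fe].
  by rewrite !extend_mapE => /val_inj/fI->.
have [] := f_apt (apartment_of (codom e)).
  by exists (codom e) => //; apply: frame_base.
move=> B Bb EB; exists (fun i : 'I_n => nth 0 B i); first exact: base_frame.
move=> S Sk; have [|X XE] := grassmannian_val (X := frame_span e S).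
  by rewrite (dim_frame_span _ fe).
have : apartment_of B (f X).
  rewrite -EB; exists X => //; exists [seq e i | i in S].
    by move=> x /fintype.imageP[i _ ->]; apply: codom_f.
  rewrite XE (@span_frame_span e) => [|_ /fintype.imageP[i _ ->]]; last exact: codom_f.
  congr frame_span; apply/setP=> i; rewrite inE fintype.mem_image //.
  exact: frame_inj fe.
case=> s sB fXE.
have fB := base_frame Bb.
have E : <<s>>%VS = frame_span (fun i : 'I_n => nth 0 B i)
    [set i : 'I_n | nth 0 B i \in s].
  apply: span_frame_span => x /sB xB; apply/codomP.
  have ltx : (index x B < n)%N by rewrite -dimH -Bb.2 index_mem.
  by exists (Ordinal ltx); rewrite nth_index.
(* This set has [k] elements because it indexes a basis of [f X]. *)
exists [set i : 'I_n | nth 0 B i \in s]; last by rewrite -XE extend_mapE fXE.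
by rewrite -(dim_frame_span _ fB) -E -fXE; apply/eqP/(valP (f X)).
Qed.

End Apartments.

Local Open Scope classical_set_scope.

Theorem theorem1 (R : realType) (H : vectType R[i]) (ip : inner_product H)
    (n k : nat) (dimH : \dim {:H} = n) (n_ge3 : (3 <= n)%N)
    (k_ge1 : (1 <= k)%N) (k_le : (k <= n - 1)%N) (n_neq2k : n <> (2 * k)%N)
    (exc6 : n = 6%N -> k \notin [:: 2; 4]%N)
    (f : grassmannian H k -> grassmannian H k) (f_bij : bijective f)
    (f_apt : forall A : set (grassmannian H k),
       orthogonal_apartment ip A -> orthogonal_apartment ip (f @` A)) :
  exists U : H -> H, (unitary ip U \/ conjugate_unitary ip U) /\ induced_by f U.
Proof.
have fP := extend_map_apartment_preserving dimH (bij_inj f_bij) f_apt.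
have dimI : #|'I_n| = \dim {:H} by rewrite card_ord dimH.
have [|||U Uu UE] := apartment_preserving_induced dimI _ _ _ fP;
  rewrite ?card_ord //; first by lia.
exists U; split=> // X; apply/seteqP; split=> y /=.
  rewrite -extend_mapE => /(UE _ (eqP (valP X)))[x xX ->].
  by exists x.
move=> [x xX <-]; rewrite -extend_mapE; apply/(UE _ (eqP (valP X))).
by exists x.
Qed.
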